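(* Let $d\ge2$, $\epsilon>0$ and $0<\beta<1/2$. With probability tending to $1$ over $G\sim\mathcal G_d(N,1/2,N^\beta)$, the following holds: for every $\lambda>1$ there exists an initial state from which the expected time for the Metropolis process on $G$ with parameter $\lambda$ to reach a clique of size at least $m$ exceeds $N^{\Omega((\log_2N)^{1/(d-1)})}$, where $$m=2\Big\lceil\Big(\big(1+\tfrac23\epsilon\big)\tfrac{d!}{2}\log_2N\Big)^{\frac1{d-1}}\Big\rceil-\Big\lceil\Big(\big(1+\tfrac23\epsilon\big)(d-1)!\log_2N\Big)^{\frac1{d-1}}\Big\rceil.$$
   Context: $\mathcal G_d(N,1/2,\kappa)$: random $d$-uniform hypergraph on $[N]$ with each $d$-subset a hyperedge independently with probability $1/2$, plus all $d$-subsets of a uniformly random $\kappa$-subset (the planted clique). A clique is a vertex subset all of whose $d$-subsets are hyperedges (including the empty set and sets of size $<d$). The Metropolis process with parameter $\lambda\ge1$ is the Markov chain on the set of cliques of $G$: from the current clique $K$, pick a vertex $v$ uniformly from $[N]$; if $v\notin K$ and $K\cup\{v\}$ is a clique, move to $K\cup\{v\}$; if $v\notin K$ and $K\cup\{v\}$ is not a clique, stay at $K$; if $v\in K$, move to $K\setminus\{v\}$ with probability $1/\lambda$ and otherwise stay at $K$. *)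

(* Defs.v *)
From HB Require Import structures.
From mathcomp Require Import all_boot all_order all_algebra.
From mathcomp Require Import all_classical all_reals all_analysis.
Set Implicit Arguments. Unset Strict Implicit. Unset Printing Implicit Defensive.
Import Order.TTheory GRing.Theory Num.Theory.
Local Open Scope ring_scope.

Section Defs.
Variable R : realType.

(* A d-uniform hypergraph on [N] = 'I_N is a set of d-subsets of 'I_N. *)
Definition dsets (N d : nat) : {set {set 'I_N}} := [set e : {set 'I_N} | #|e| == d].

(* K is a clique: every d-subset of K is a hyperedge (vacuous if #|K| < d). *)
Definition is_clique (N d : nat) (G : {set {set 'I_N}}) (K : {set 'I_N}) : bool :=
  [forall e : {set 'I_N}, ((e \subset K) && (#|e| == d)) ==> (e \in G)].

Definition clique_edges (N d : nat) (S : {set 'I_N}) : {set {set 'I_N}} :=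
  [set e in dsets N d | e \subset S].

(* Probability of an event P under G_d(N, 1/2, kappa): the planted set S is a
   uniformly random kappa-subset, H is an independent uniformly random set of
   d-subsets (each d-subset independently with probability 1/2), and
   G = H U (d-subsets of S). *)
Definition probG (N d kappa : nat) (P : {set {set 'I_N}} -> Prop) : R :=
  (#|[set S : {set 'I_N} | #|S| == kappa]|%:R)^-1 *
  \sum_(S : {set 'I_N} | #|S| == kappa)
    \sum_(H in powerset (dsets N d))
      ((2%:R ^+ #|dsets N d|)^-1 *
        (if `[< P (H :|: clique_edges d S) >] then 1 else 0)).

(* q t K = probability that the Metropolis process (parameter lam) on G
   started at K has not visited a clique of size >= m during times 0..t,
   i.e. P_K(T > t) where T is the hitting time of {K : #|K| >= m}. *)
Fixpoint notHit (N d : nat) (G : {set {set 'I_N}}) (lam : R) (m : int)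
    (t : nat) (K : {set 'I_N}) : R :=
  if (m <= (#|K|)%:Z) then 0 else
  match t with
  | 0%N => 1
  | t'.+1 =>
      (N%:R)^-1 * \sum_(v : 'I_N)
        (if v \in K then
           lam^-1 * notHit d G lam m t' (K :\ v) + (1 - lam^-1) * notHit d G lam m t' K
         else if is_clique d G (v |: K) then notHit d G lam m t' (v |: K)
         else notHit d G lam m t' K)
  end.

(* Expected hitting time E_K[T] = sum_{t >= 0} P_K(T > t), in [0, +oo]. *)
Definition expected_hitting_time (N d : nat) (G : {set {set 'I_N}}) (lam : R)
    (m : int) (K : {set 'I_N}) : \bar R :=
  (\sum_(0 <= t <oo) (notHit d G lam m t K)%:E)%E.

Definition log2 (x : R) : R := ln x / ln 2.

Definition target_size (d N : nat) (eps : R) : int :=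
  2 * Num.ceil (((1 + 2 / 3 * eps) * ((d`!)%:R / 2) * log2 N%:R) `^ ((d.-1)%:R)^-1)
  - Num.ceil (((1 + 2 / 3 * eps) * ((d.-1)`!)%:R * log2 N%:R) `^ ((d.-1)%:R)^-1).

Definition kappa (N : nat) (beta : R) : nat := Num.truncn ((N%:R : R) `^ beta).

End Defs.

(* Main.v *)
(* The stationary weight of a clique [K] is [lam ^ #|K|], so it is constant on the
   cliques of a given size [k] and there the comparison of two families of cliques
   does not depend on [lam].  A path from a small clique to one of size [k + a]
   visits, at its last passage through size [k], a clique [K] and later reaches a
   clique with exactly [a] vertices outside [K] and at least [k - a] inside.  The
   [k]-cliques [K] which admit such an extension (gateways) form an
   [N ^ (- Omega(k))] proportion of all [k]-cliques: a first moment bounds their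
   number, a second moment bounds the number of [k]-cliques from below, and cliques
   with a large intersection with the planted set are treated as gateways, being
   rare because [beta < 1/2].  Started from stationarity away from the cliques
   beyond the gateways, the process needs on average at least the inverse of this
   proportion to get through.  Since the target size exceeds
   [(1 + s) ((d-1)! log2 N)^(1/(d-1))] for some [s > 0], a value of [k] slightly
   above [((d-1)! log2 N)^(1/(d-1))] is enough. *)

Require Import Defs.
From HB Require Import structures.
From mathcomp Require Import all_boot all_order all_algebra.
From mathcomp Require Import all_classical all_reals all_analysis.
From mathcomp Require Import ring lra zify.
Set Implicit Arguments. Unset Strict Implicit. Unset Printing Implicit Defensive.
Import Order.TTheory GRing.Theory Num.Theory numFieldNormedType.Exports.
Local Open Scope ring_scope.

(** * The Metropolis process and its exits from a set of cliques *)

Lemma is_cliqueE (N d : nat) (G : {set {set 'I_N}}) (K : {set 'I_N}) :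
  is_clique d G K = (clique_edges d K \subset G).
Proof.
apply/forallP/fintype.subsetP => [H e|H e].
  by rewrite !inE => /andP[e1 e2]; move: (H e); rewrite e1 e2.
by apply/implyP => /andP[e1 e2]; apply: H; rewrite !inE e1 e2.
Qed.

Lemma clique_edgesS (N d : nat) (A B : {set 'I_N}) :
  A \subset B -> clique_edges d A \subset clique_edges d B.
Proof.
move=> AB; apply/fintype.subsetP => e; rewrite !inE => /andP[-> /=] eA.
exact: fintype.subset_trans eA AB.
Qed.

Lemma is_clique_sub (N d : nat) (G : {set {set 'I_N}}) (A B : {set 'I_N}) :
  A \subset B -> is_clique d G B -> is_clique d G A.
Proof. by rewrite !is_cliqueE => /(clique_edgesS d); exact: fintype.subset_trans. Qed.

(** One-step expectation of [f] given that [v] is the vertex drawn; the transition operator is its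
    average over [v]. *)
Definition move (R : realType) (N : nat) (d : nat) (G : {set {set 'I_N}}) (lam : R)
    (v : 'I_N) (f : {set 'I_N} -> R) (K : {set 'I_N}) : R :=
  if v \in K then lam^-1 * f (K :\ v) + (1 - lam^-1) * f K
  else if is_clique d G (v |: K) then f (v |: K) else f K.

Section Hitting.
Variables (R : realType) (N d : nat) (G : {set {set 'I_N}}) (lam : R).
Hypothesis lam1 : 1 < lam.

Let lam0 : 0 < lam. Proof. exact: lt_trans lam1. Qed.
Let laminv0 : 0 <= lam^-1. Proof. by rewrite invr_ge0 ltW. Qed.
Let laminv1 : 0 <= 1 - lam^-1. Proof. by rewrite subr_ge0 invf_le1 // ltW. Qed.

(* Detailed balance within each pair [K], [v |: K]. *)
Lemma move_stationary (v : 'I_N) (f : {set 'I_N} -> R) :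
  \sum_(K | is_clique d G K) lam ^+ #|K| * move d G lam v f K
  = \sum_(K | is_clique d G K) lam ^+ #|K| * f K.
Proof.
(* Adding [v] pairs cliques up; the unpaired ones avoid [v] and cannot be extended by it, and there
   the move is the identity. *)
have split F : \sum_(K | is_clique d G K) F K =
   \sum_(K : {set 'I_N} | (v \notin K) && is_clique d G (v |: K)) (F K + F (v |: K)) +
   \sum_(K : {set 'I_N} | is_clique d G K && ((v \notin K) && ~~ is_clique d G (v |: K))) F K :> R.
  rewrite (bigID (fun K : {set 'I_N} => (v \notin K) && ~~ is_clique d G (v |: K))) /= addrC.
  congr (_ + _).
  rewrite (bigID (fun K : {set 'I_N} => v \notin K)) /= big_split /=; congr (_ + _).
    apply: eq_bigl => K; case: (boolP (v \in K)) => vK; rewrite /= ?andbF ?andbT ?negbK //.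
    apply/andP/idP => [[//]|H]; split=> //; apply: is_clique_sub H.
    exact: finset.subsetUr.
  rewrite (reindex_onto (fun K : {set 'I_N} => v |: K) (fun K => K :\ v)) /=.
    apply: eq_bigl => K; rewrite setU11 /= andbT.
    case: (boolP (v \in K)) => vK /=.
      rewrite andbC; apply/negP => /andP[/eqP E _].
      by move: vK; rewrite -E !inE eqxx.
    rewrite setU1K // eqxx ?andbT //.
  by move=> K /andP[_]; rewrite negbK => vK; rewrite finset.setD1K.
rewrite (split (fun K => lam ^+ #|K| * move d G lam v f K)).
rewrite (split (fun K => lam ^+ #|K| * f K)); congr (_ + _); last first.
  by apply: eq_bigr => K /andP[_ /andP[/negbTE vK /negbTE H]]; rewrite /move vK H.
apply: eq_bigr => K /andP[vK H]; rewrite /move (negbTE vK) H setU11 setU1K //.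
rewrite cardsU1 vK add1n exprS; field; exact: lt0r_neq0.
Qed.

Lemma notHit0 (m : int) (K : {set 'I_N}) t : m <= (#|K|)%:Z -> notHit d G lam m t K = 0.
Proof. by case: t => [|t] /= ->. Qed.

Lemma notHitS (m : int) (K : {set 'I_N}) t : ~~ (m <= (#|K|)%:Z) ->
  notHit d G lam m t.+1 K = (N%:R)^-1 * \sum_(v : 'I_N) move d G lam v (notHit d G lam m t) K.
Proof. by move=> /= /negbTE ->. Qed.

Lemma move_mono v (f g : {set 'I_N} -> R) K :
  (forall K, f K <= g K) -> move d G lam v f K <= move d G lam v g K.
Proof.
move=> fg; rewrite /move; case: ifP => _; last by case: ifP.
by apply: lerD; rewrite ler_wpM2l.
Qed.

Lemma move_le1 v (f : {set 'I_N} -> R) K : (forall K, f K <= 1) -> move d G lam v f K <= 1.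
Proof.
move=> f1; apply: le_trans (@move_mono v f (fun=> 1) K f1) _; rewrite /move /=.
case: ifP => _; last by case: ifP; rewrite lexx.
lra.
Qed.

Lemma move_ge0 v (f : {set 'I_N} -> R) K : (forall K, 0 <= f K) -> 0 <= move d G lam v f K.
Proof.
move=> f1; apply: le_trans (@move_mono v (fun=> 0) f K f1); rewrite /move /=.
case: ifP => _; last by case: ifP; rewrite lexx.
lra.
Qed.

Lemma notHit_ge0 m t K : 0 <= notHit d G lam m t K.
Proof.
elim: t K => [|t IH] K; case: (boolP (m <= (#|K|)%:Z)) => mK; do 1?[by rewrite !notHit0].
  by rewrite /= (negbTE mK).
rewrite notHitS // mulr_ge0 ?invr_ge0 //; apply: sumr_ge0 => v _; exact: move_ge0.
Qed.

Lemma notHit_le1 m t K : notHit d G lam m t K <= 1.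
Proof.
elim: t K => [|t IH] K; case: (boolP (m <= (#|K|)%:Z)) => mK; do 1?[by rewrite !notHit0].
  by rewrite /= (negbTE mK).
rewrite notHitS //.
(* For [N = 0] the normalising factor is [0] by convention. *)
have [N0|N0] := posnP N.
  by have -> : N%:R^-1 = 0 :> R; [rewrite N0 invr0|rewrite mul0r].
rewrite mulrC ler_pdivrMr ?ltr0n // mul1r.
apply: le_trans (_ : \sum_(v : 'I_N) 1 <= _).
  by apply: ler_sum => v _; exact: move_le1.
by rewrite sumr_const card_ord.
Qed.

Lemma notHit_decr m t K : notHit d G lam m t.+1 K <= notHit d G lam m t K.
Proof.
elim: t K => [|t IH] K; case: (boolP (m <= (#|K|)%:Z)) => mK; do 1?[by rewrite !notHit0].
  rewrite (_ : notHit _ _ _ _ 0 _ = 1); first exact: notHit_le1.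
  by rewrite /= (negbTE mK).
rewrite !notHitS // ler_wpM2l ?invr_ge0 //; apply: ler_sum => v _; exact: move_mono.
Qed.

Section Exits.
Variables (m : int) (W Z : {set {set 'I_N}}).
Hypothesis N0 : (0 < N)%N.
Hypothesis W_clique : forall K, K \in W -> is_clique d G K && ((#|K|)%:Z < m).
Hypothesis W_up : forall K v, K \in W -> v \notin K -> is_clique d G (v |: K) ->
  v |: K \in W :|: Z.
Hypothesis W_down : forall K v, K \in W -> v \in K -> K :\ v \in W :|: Z.

(* With [f] equal to [1 - notHit] on [W], to [1] on [Z] and to [0] elsewhere, every
   step from [W] stays where [1 - notHit <= f], and stationarity preserves the
   total weight of [f]. *)
Lemma hit_weight_bound t :
  \sum_(K in W) lam ^+ #|K| * (1 - notHit d G lam m t K)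
  <= t%:R * \sum_(K in Z) lam ^+ #|K|.
Proof.
elim: t => [|t IH].
  rewrite mul0r big1 // => K /W_clique/andP[_ Km].
  by rewrite /= leNgt Km /= subrr mulr0.
set g := notHit d G lam m t.
pose f K := if K \in W then 1 - g K else if K \in Z then 1 else 0 : R.
have f0 K : 0 <= f K.
  by rewrite /f; case: ifP => _; [rewrite subr_ge0 notHit_le1|case: ifP].
have fWZ K : K \in W :|: Z -> 1 - g K <= f K.
  rewrite inE /f; case: ifP => //= _ ->; have := notHit_ge0 m t K; rewrite -/g; lra.
have w0 (K : {set 'I_N}) : 0 <= lam ^+ #|K| by rewrite exprn_ge0 // ltW.
have moveWf K v : K \in W -> 1 - move d G lam v g K <= move d G lam v f K.
  move=> KW; have KK : K \in W :|: Z by rewrite inE KW.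
  rewrite /move; case: (boolP (v \in K)) => vK.
    have h1 := fWZ _ (W_down KW vK); have h2 := fWZ _ KK.
    have : 0 <= lam^-1 * (f (K :\ v) - (1 - g (K :\ v))) by rewrite mulr_ge0 ?subr_ge0.
    have : 0 <= (1 - lam^-1) * (f K - (1 - g K)) by rewrite mulr_ge0 // subr_ge0.
    lra.
  by case: (boolP (is_clique d G (v |: K))) => [/(W_up KW vK)|_]; exact: fWZ.
have step K : K \in W -> 1 - notHit d G lam m t.+1 K <=
    (N%:R)^-1 * \sum_(v : 'I_N) move d G lam v f K.
  move=> KW; rewrite notHitS; last by rewrite -ltNge; case/andP: (W_clique KW).
  have {1}<- : (N%:R)^-1 * \sum_(v : 'I_N) 1 = 1 :> R.
    by rewrite sumr_const card_ord mulVf // pnatr_eq0 -lt0n.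
  rewrite -mulrBr -sumrB ler_wpM2l ?invr_ge0 //; apply: ler_sum => v _; exact: moveWf.
apply: le_trans (_ : \sum_(K in W) lam ^+ #|K| *
    ((N%:R)^-1 * \sum_(v : 'I_N) move d G lam v f K) <= _).
  by apply: ler_sum => K KW; rewrite ler_wpM2l // step.
(* Stationarity concerns the sum over all cliques; the terms added here are nonnegative. *)
apply: le_trans (_ : \sum_(K | is_clique d G K) lam ^+ #|K| *
    ((N%:R)^-1 * \sum_(v : 'I_N) move d G lam v f K) <= _).
  rewrite big_mkcond [leRHS]big_mkcond /=; apply: ler_sum => K _.
  case: ifP => [/W_clique/andP[-> //]|_]; case: ifP => // _.
  rewrite !mulr_ge0 ?invr_ge0 //; apply: sumr_ge0 => v _; exact: move_ge0.
have -> : \sum_(K | is_clique d G K) lam ^+ #|K| *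
    ((N%:R)^-1 * \sum_(v : 'I_N) move d G lam v f K) =
    \sum_(K | is_clique d G K) lam ^+ #|K| * f K.
  under eq_bigr do rewrite mulrCA mulr_sumr.
  rewrite -mulr_sumr exchange_big /=.
  under eq_bigr do rewrite move_stationary.
  by rewrite sumr_const card_ord -[X in _ * X = _]mulr_natl mulrA mulVf ?mul1r // pnatr_eq0 -lt0n.
(* Outside [W], the function [f] lives on [Z] only: one copy of the weight of [Z] is gained per unit
   of time. *)
apply: le_trans (_ : \sum_(K in W) lam ^+ #|K| * (1 - g K) + \sum_(K in Z) lam ^+ #|K| <= _).
  rewrite big_mkcond [\sum_(_ in W) _]big_mkcond [\sum_(_ in Z) _]big_mkcond -big_split /=.
  apply: ler_sum => K _; rewrite /f.
  case: ifP => _; case: ifP => KW; case: ifP => KZ; rewrite ?mulr0 ?mulr1 ?addr0 ?add0r //.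
  - by rewrite lerDl.
  - by rewrite addr_ge0 // mulr_ge0 // subr_ge0 notHit_le1.
  - by rewrite mulr_ge0 // subr_ge0 notHit_le1.
rewrite -natr1 mulrDl mul1r; exact: lerD.
Qed.

(** If every start in [W] had hit with probability above one half, the [k]-cliques of [W] alone
    would violate [hit_weight_bound]. They have the same size as the members of [Z], so [lam ^+ k]
    cancels and only cardinals are compared. *)
Lemma exists_slow_start (k : nat) (t : nat) :
  (forall K, K \in Z -> #|K| = k) ->
  (0 < #|[set K in W | #|K| == k]|)%N ->
  (t * #|Z| * 2 <= #|[set K in W | #|K| == k]|)%N ->
  exists2 K0, K0 \in W & 1 / 2 <= notHit d G lam m t K0.
Proof.
move=> Zk n0 tZ; apply/exists_inP; apply: contraPT (hit_weight_bound t).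
rewrite negb_exists => /forallP H; apply/negP; rewrite -ltNge.
have HW K : K \in W -> 1 / 2 < 1 - notHit d G lam m t K.
  by move=> KW; move: (H K); rewrite KW /= -ltNge; lra.
have -> : \sum_(K in Z) lam ^+ #|K| = (#|Z|)%:R * lam ^+ k.
  by rewrite (eq_bigr (fun=> lam ^+ k)) => [|K /Zk -> //]; rewrite sumr_const mulr_natl.
set n := #|[set K in W | #|K| == k]| in n0 tZ.
have w0 j : 0 < lam ^+ j by rewrite exprn_gt0.
apply: (@le_lt_trans _ _ (n%:R * lam ^+ k * (1 / 2))).
  rewrite mulrA -natrM.
  have : (t * #|Z| * 2)%:R <= n%:R :> R by rewrite ler_nat.
  rewrite natrM => hh; have := w0 k; move: (lam ^+ k) => w; nra.
(* This clique makes the inequality strict. *)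
have [K1 K1n] : exists K1, K1 \in [set K in W | #|K| == k] by apply/card_gt0P.
have -> : n%:R * lam ^+ k * (1 / 2) = \sum_(K in W | #|K| == k) lam ^+ #|K| * (1/2).
  rewrite (eq_bigr (fun=> lam ^+ k * (1/2))) => [|K /andP[_ /eqP -> //]].
  rewrite sumr_const -mulrA mulr_natl; congr (_ *+ _).
  by apply: eq_card => K; rewrite /n !inE.
apply: (@lt_le_trans _ _ (\sum_(K in W | #|K| == k) lam ^+ #|K| * (1 - notHit d G lam m t K))).
  rewrite (bigD1 K1) /=; last by move: K1n; rewrite inE.
  rewrite [ltRHS](bigD1 K1) /=; last by move: K1n; rewrite inE.
  move: K1n; rewrite inE => /andP[K1W _].
  apply: ltr_leD; first by rewrite ltr_pM2l // HW.
  by apply: ler_sum => K /andP[/andP[KW _] _]; rewrite ler_wpM2l ?ltW // HW.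
rewrite [leRHS](bigID (fun K : {set 'I_N} => #|K| == k)) /= lerDl.
by apply: sumr_ge0 => K _; rewrite mulr_ge0 ?(ltW (w0 _)) // subr_ge0 notHit_le1.
Qed.

End Exits.

(** Survival probabilities decrease in time, so the first [t.+1] terms of the series are all at
    least one half. *)
Lemma hitting_time_ge (m : int) (K : {set 'I_N}) t :
  1 / 2 <= notHit d G lam m t K ->
  ((t.+1%:R / 2)%:E <= expected_hitting_time d G lam m K)%E.
Proof.
move=> ht.
apply: (@le_trans _ _ (\sum_(0 <= s < t.+1) (notHit d G lam m s K)%:E)%E); last first.
  by apply: nneseries_lim_ge => s _ _; rewrite lee_fin notHit_ge0.
rewrite sumEFin lee_fin.
have -> : t.+1%:R / 2 = \sum_(0 <= s < t.+1) (1 / 2) :> R.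
  by rewrite sumr_const_nat subn0 div1r mulr_natl.
rewrite !big_mkord; apply: ler_sum => s _; apply: le_trans ht _.
have : (s <= t)%N by rewrite -ltnS.
move: (nat_of_ord s) => {}s; elim: t => [|t IH]; first by rewrite leqn0 => /eqP ->.
rewrite leq_eqVlt => /predU1P[-> //|st]; apply: le_trans (notHit_decr _ _ _) _.
exact: IH.
Qed.

End Hitting.

(** * Gateways as a bottleneck between small and large cliques *)

Lemma exists_subset_card (T : finType) (X : {set T}) b :
  (b <= #|X|)%N -> exists2 B : {set T}, B \subset X & #|B| = b.
Proof.
rewrite -bin_gt0 -cards_draws => /card_gt0P[B]; rewrite inE => /andP[BX /eqP Bb].
by exists B.
Qed.

(* The first alternative isolates the cliques which the planted set makes too
   likely; the second one is the trace at [K] of a path of cliques of size at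
   least [a + b] which starts at [K] and ends [a] steps higher. *)
Definition gateway (N d : nat) (G : {set {set 'I_N}}) (S : {set 'I_N}) (a b h : nat)
    (K : {set 'I_N}) : bool :=
  (h <= #|K :&: S|)%N ||
  [exists A : {set 'I_N}, exists B : {set 'I_N},
     [&& [disjoint A & K], #|A| == a, B \subset K, #|B| == b & is_clique d G (A :|: B)]].

Definition kcliques (N d : nat) (G : {set {set 'I_N}}) (k : nat) : {set {set 'I_N}} :=
  [set K : {set 'I_N} | (#|K| == k) && is_clique d G K].

Definition gateways (N d : nat) (G : {set {set 'I_N}}) (S : {set 'I_N}) (a b h : nat) :=
  [set K in kcliques d G (a + b) | gateway d G S a b h K].

(** Inside the set [W] below, a path at size [k] or more carries along a non-gateway [k]-clique
    [K1]. Getting [a] vertices away from [K1] would make [K1] a gateway, so [W] can be left only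
    through gateways, and its cliques stay smaller than [k + a]. *)
Lemma gateway_bottleneck (R : realType) (N d : nat) (G : {set {set 'I_N}}) (lam : R)
    (m : int) (S : {set 'I_N}) (a b h t : nat) :
  1 < lam -> (0 < N)%N -> (0 < a)%N -> (a + b + a)%:Z <= m ->
  (0 < #|kcliques d G (a + b) :\: gateways d G S a b h|)%N ->
  (t * #|gateways d G S a b h| * 2 <= #|kcliques d G (a + b) :\: gateways d G S a b h|)%N ->
  exists K0, is_clique d G K0 /\
    ((t.+1%:R / 2)%:E <= expected_hitting_time d G lam m K0)%E.
Proof.
move=> lam1 N0 a0; set k := (a + b)%N => km.
set Q := kcliques d G k; set Z := gateways d G S a b h => n0 tZ.
pose W := [set K : {set 'I_N} | is_clique d G K && ((#|K| < k)%N ||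
   [exists K1 in Q :\: Z, #|K :\: K1| < a]%N)].
have WE (K : {set 'I_N}) : K \in W = is_clique d G K && ((#|K| < k)%N ||
   [exists K1 in Q :\: Z, #|K :\: K1| < a]%N) by rewrite inE.
have QZE K : K \in Q :\: Z = (K \notin Z) && (#|K| == k) && is_clique d G K.
  by rewrite !inE andbA.
have QZW (K : {set 'I_N}) : K \in Q :\: Z -> K \in W.
  move=> KQ; rewrite WE; move: (KQ); rewrite QZE => /andP[_ ->] /=; apply/orP; right; apply/exists_inP; exists K => //.
  by rewrite finset.setDv cards0.
have W_clique (K : {set 'I_N}) : K \in W -> is_clique d G K && ((#|K|)%:Z < m).
  rewrite WE => /andP[-> /= H]; apply: lt_le_trans km; rewrite ltz_nat.
  case/orP: H => [|/exists_inP[K1]]; first by lia.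
  rewrite QZE => /andP[/andP[_ /eqP K1k] _] Ka.
  by rewrite -(cardsID K1 K) -addnS leq_add // -K1k subset_leq_card ?finset.subsetIr.
have W_down (K : {set 'I_N}) v : K \in W -> v \in K -> K :\ v \in W :|: Z.
  rewrite finset.in_setU !WE => /andP[Kc KW] vK; apply/orP; left.
  rewrite (is_clique_sub (subD1set _ _) Kc) /=.
  case/orP: KW => [Kk|/exists_inP[K1 K1Q Ka]]; apply/orP.
    by left; apply: leq_ltn_trans Kk; rewrite subset_leq_card ?subD1set.
  right; apply/exists_inP; exists K1 => //; apply: leq_ltn_trans Ka.
  by apply: subset_leq_card; apply: finset.setSD; exact: subD1set.
have W_up (K : {set 'I_N}) v : K \in W -> v \notin K -> is_clique d G (v |: K) -> v |: K \in W :|: Z.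
  rewrite WE => /andP[Kc KW] vK vKc.
  have cK : #|v |: K| = #|K|.+1 by rewrite cardsU1 vK.
  rewrite finset.in_setU; case: (boolP (v |: K \in Z)) => [|vZ]; first by rewrite orbT.
  rewrite orbF; have [Kk|kK] := ltnP #|v |: K| k.
    by rewrite WE vKc Kk.
  (* A non-gateway reached at size [k] becomes its own reference clique. *)
  have [Kk|Kk] := eqVneq #|v |: K| k.
    by apply: QZW; rewrite QZE vZ Kk eqxx.
  case/orP: KW => [|/exists_inP[K1 K1Q Ka]]; first by lia.
  rewrite WE vKc /=; apply/orP; right; apply/exists_inP; exists K1 => //.
  rewrite ltn_neqAle; apply/andP; split; last first.
    apply: leq_trans Ka; rewrite finset.setDUl; apply: leq_trans (leq_card_setU _ _) _.
    have := subset_leq_card (finset.subsetDl [set v] K1); rewrite cards1; lia.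
  apply/negP => /eqP Ea; move: K1Q; rewrite QZE -andbA => /andP[/negP K1Z /andP[/eqP K1k K1c]].
  (* With size at least [a + b] and exactly [a] vertices outside [K1], at least [b] lie inside; the
     two parts exhibit [K1] as a gateway. *)
  have [B BK Bb] : exists2 B : {set 'I_N}, B \subset (v |: K) :&: K1 & #|B| = b.
    apply: exists_subset_card; move: kK; rewrite -(cardsID K1 (v |: K)) Ea /k [(a + b)%N]addnC.
    by rewrite leq_add2r.
  apply: K1Z; rewrite !inE K1k K1c eqxx /=; apply/orP; right; apply/existsP; exists ((v |: K) :\: K1).
  apply/existsP; exists B; rewrite Ea Bb !eqxx /= (fintype.subset_trans BK) ?finset.subsetIr //.
  rewrite (is_clique_sub _ vKc) ?andbT /=.
    by rewrite -setI_eq0; apply/eqP/setP => x; rewrite !inE; case: (x \in K1); rewrite ?andbF.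
  by rewrite finset.subUset finset.subsetDl /= (fintype.subset_trans BK) // finset.subsetIl.
have Zk (K : {set 'I_N}) : K \in Z -> #|K| = k by rewrite !inE => /andP[/andP[/eqP]].
have sub : (#|Q :\: Z| <= #|[set K in W | #|K| == k]|)%N.
  apply: subset_leq_card; apply/fintype.subsetP => K KQ; rewrite inE QZW //=.
  by move: KQ; rewrite QZE => /andP[/andP[]].
have [K0 K0W g0] := exists_slow_start lam1 N0 W_clique W_up W_down Zk
  (leq_trans n0 sub) (leq_trans tZ sub).
exists K0; split; first by case/andP: (W_clique _ K0W).
by have := hitting_time_ge lam1 g0.
Qed.

(** * Counting sets by their intersection with a given set *)

Lemma card_supersets (T : finType) (F D : {set T}) :
  F \subset D -> #|[set H : {set T} | (F \subset H) && (H \subset D)]| = (2 ^ #|D :\: F|)%N.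
Proof.
move=> FD; rewrite -card_powerset.
rewrite -[RHS](card_in_imset (f := fun X : {set T} => F :|: X)).
  apply: eq_card => H; apply/idP/imsetP => [|[X]].
    rewrite inE => /andP[FH HD].
    exists (H :\: F); first by rewrite powersetE finset.setSD.
    apply/setP => x; rewrite !inE; case: (boolP (x \in F)) => //= xF.
    by rewrite (fintype.subsetP FH).
  rewrite powersetE => XD ->; rewrite inE finset.subsetUl finset.subUset FD.
  by rewrite (fintype.subset_trans XD) // finset.subsetDl.
move=> X Y; rewrite !powersetE !finset.subsetD => /andP[_ /disjoint_setI0 X0] /andP[_ /disjoint_setI0 Y0] E.
have -> : X = (F :|: X) :\: F.
  by apply/setP => x; move/setP/(_ x): X0; rewrite !inE; case: (x \in F); case: (x \in X).
rewrite E.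
by apply/setP => x; move/setP/(_ x): Y0; rewrite !inE; case: (x \in F); case: (x \in Y).
Qed.

(** The ratio of the binomials is the product over [j < i] of [(k - j) / (N - j)], each factor being
    at most [k / N]. *)
Lemma bin_ratio (N k i : nat) : (i <= k)%N -> (k <= N)%N ->
  ('C(N - i, k - i) * N ^ i <= k ^ i * 'C(N, k))%N.
Proof.
move=> ik kN; elim: i ik => [|i IH] ik; first by rewrite !subn0 !expn0 muln1 mul1n.
have {}IH := IH (ltnW ik).
have E : ((N - i) * 'C(N - i.+1, k - i.+1) = (k - i) * 'C(N - i, k - i))%N.
  by have := mul_bin_diag (N - i) (k - i.+1); rewrite -subnS -[(_ - i.+1).+1]subSn // subSS.
have Ni : (0 < N - i)%N by rewrite subn_gt0; lia.
rewrite -(leq_pmul2l Ni) !expnS.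
have -> : ((N - i) * ('C(N - i.+1, k - i.+1) * (N * N ^ i)) =
  ((k - i) * N) * ('C(N - i, k - i) * N ^ i))%N.
  by rewrite mulnA E; lia.
have -> : ((N - i) * (k * k ^ i * 'C(N, k)) = (k * (N - i)) * (k ^ i * 'C(N, k)))%N by lia.
by apply: leq_mul => //; rewrite mulnBl mulnBr; nia.
Qed.

Lemma ffact_le_exp (n i : nat) : (n ^_ i <= n ^ i)%N.
Proof.
elim: i => [|i IH]; first by rewrite ffactn0.
by rewrite ffactnSr expnSr leq_mul // leq_subr.
Qed.

Lemma bin_le_exp (s i : nat) : ('C(s, i) <= s ^ i)%N.
Proof.
by apply: leq_trans (ffact_le_exp s i); rewrite -bin_ffact leq_pmulr // fact_gt0.
Qed.

(** The parts inside and outside [S] are chosen separately. Unless [S] has fewer than [i] elements,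
    its complement has at most [N - i], and [bin_ratio] applies. *)
Lemma card_meet_le (N k i : nat) (S : {set 'I_N}) : (i <= k)%N -> (k <= N)%N ->
  (#|[set K : {set 'I_N} | (#|K| == k) && (#|K :&: S| == i)]| * N ^ i
   <= (#|S| * k) ^ i * 'C(N, k))%N.
Proof.
move=> ik kN.
have [iS|Si] := leqP i #|S|; last first.
  rewrite (_ : #|_| = 0%N) ?mul0n //; apply: eq_card0 => K; rewrite !inE.
  apply/negP => /andP[_ /eqP Ei].
  by move: Si; rewrite -Ei ltnNge subset_leq_card ?finset.subsetIr.
have H : (#|[set K : {set 'I_N} | (#|K| == k) && (#|K :&: S| == i)]|
  <= 'C(#|S|, i) * 'C(N - i, k - i))%N.
  pose P := finset.setX [set I : {set 'I_N} | (I \subset S) && (#|I| == i)]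
                 [set I : {set 'I_N} | (I \subset ~: S) && (#|I| == k - i)%N].
  apply: leq_trans (_ : #|(fun p => p.1 :|: p.2) @: P| <= _)%N.
    apply: subset_leq_card; apply/fintype.subsetP => K; rewrite inE => /andP[/eqP Kk /eqP Ki].
    apply/imsetP; exists (K :&: S, K :\: S); last by rewrite /= finset.setID.
    rewrite !inE /= finset.subsetIr Ki eqxx /= finset.subDset.
    rewrite finset.setUCr finset.subsetT /= -Kk -(cardsID S K) Ki.
    by rewrite addnC addnK.
  apply: leq_trans (leq_imset_card _ _) _; rewrite cardsX !cards_draws.
  by rewrite leq_mul // leq_bin2l // cardsCs finset.setCK card_ord leq_sub2l.
apply: leq_trans (leq_mul H (leqnn _)) _; rewrite -mulnA expnMn -mulnA.
by apply: leq_mul; [exact: bin_le_exp|exact: bin_ratio].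
Qed.

Lemma sum_meet_le (R : realType) (N k h : nat) (S : {set 'I_N}) (c : nat -> R) :
  (0 < N)%N -> (k <= N)%N -> (forall i, 0 <= c i) ->
  \sum_(K : {set 'I_N} | (#|K| == k) && (h <= #|K :&: S|)%N) c #|K :&: S|
  <= 'C(N, k)%:R * \sum_(i < k.+1 | (h <= i)%N) (#|S|%:R * k%:R / N%:R) ^+ i * c i.
Proof.
move=> N0 kN c0; rewrite mulr_sumr.
have meet_lt (K : {set 'I_N}) : #|K| == k -> (#|K :&: S| < k.+1)%N.
  by move=> /eqP <-; rewrite ltnS subset_leq_card // finset.subsetIl.
rewrite (partition_big (fun K : {set 'I_N} => inord #|K :&: S| : 'I_k.+1)
  (fun i : 'I_k.+1 => (h <= i)%N)) /=; last first.
  by move=> K /andP[Kk]; rewrite inordK // meet_lt.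
apply: ler_sum => i hi.
rewrite (eq_bigr (fun=> c i)); last first.
  by move=> K /andP[/andP[Kk _] /eqP <-]; rewrite inordK // meet_lt.
rewrite (eq_bigl (fun K => K \in [set K : {set 'I_N} | (#|K| == k) && (#|K :&: S| == i)%N])).
  rewrite sumr_const -[_ *+ _]mulr_natl mulrA ler_wpM2r //.
  rewrite expr_div_n -natrM -!natrX mulrA ler_pdivlMr ?ltr0n ?expn_gt0 ?N0 //.
  by rewrite -!natrM ler_nat [leqRHS]mulnC card_meet_le // -ltnS.
move=> K; rewrite inE; case: (boolP (#|K| == k)) => //= Kk.
by rewrite -val_eqE /= inordK ?meet_lt //; case: eqP => [->|]; rewrite ?andbT ?andbF.
Qed.

Lemma sum_geometric_le (R : realType) (r : R) (n h : nat) : 0 <= r -> r <= 1 / 2 ->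
  \sum_(i < n | (h <= i)%N) r ^+ i <= 2 * r ^+ h.
Proof.
move=> r0 r2.
(* The subtracted term closes the induction, as [r ^+ n + 2 * r ^+ n.+1 <= 2 * r ^+ n]. *)
suff : \sum_(i < n | (h <= i)%N) r ^+ i <= 2 * r ^+ h - (if (h <= n)%N then 2 * r ^+ n else 0).
  move=> H; apply: le_trans H _; rewrite lerBlDr lerDl.
  by case: ifP => // _; rewrite mulr_ge0 // exprn_ge0.
elim: n => [|n IH].
  rewrite big_ord0; case: ifP; last by rewrite subr0 mulr_ge0 // exprn_ge0.
  by rewrite leqn0 => /eqP ->; rewrite subrr.
rewrite big_mkcond big_ord_recr -big_mkcond /=.
have rn : 0 <= r ^+ n by rewrite exprn_ge0.
move: IH; have [hn|nh] := leqP h n; first by rewrite leqW // exprS; nra.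
case: ifP => [hn|_]; last by rewrite addr0.
have -> : h = n.+1 by apply/eqP; rewrite eqn_leq hn.
rewrite subr0 subrr big1 ?addr0 // => i; have := ltn_ord i; lia.
Qed.

(** Used for all overlap sums below: once each common vertex costs a factor [r], the smallest
    allowed overlap dominates. *)
Lemma sum_meet_geometric (R : realType) (N k h : nat) (S : {set 'I_N}) (c : nat -> R) (r : R) :
  (0 < N)%N -> (k <= N)%N -> (forall i, 0 <= c i) -> 0 <= r -> r <= 1 / 2 ->
  (forall i, (i <= k)%N -> (#|S|%:R * k%:R / N%:R) ^+ i * c i <= r ^+ i) ->
  \sum_(K : {set 'I_N} | (#|K| == k) && (h <= #|K :&: S|)%N) c #|K :&: S|
  <= 'C(N, k)%:R * (2 * r ^+ h).
Proof.
move=> N0 kN c0 r0 r2 H; apply: le_trans (sum_meet_le h S N0 kN c0) _.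
rewrite ler_wpM2l //; apply: le_trans (sum_geometric_le k.+1 h r0 r2).
by apply: ler_sum => i _; apply: H; rewrite -ltnS.
Qed.

(** * Moments of clique counts in the random hypergraph *)

(** Expectation over the random hypergraph with the planted set held fixed, as in the inner sum of
    [probG]. *)
Definition expectH (R : realType) (N d : nat) (f : {set {set 'I_N}} -> R) : R :=
  \sum_(H in powerset (dsets N d)) (2%:R ^+ #|dsets N d|)^-1 * f H.

Lemma le_expectH (R : realType) (N d : nat) (f g : {set {set 'I_N}} -> R) :
  (forall H : {set {set 'I_N}}, H \subset dsets N d -> f H <= g H) -> expectH d f <= expectH d g.
Proof.
move=> fg; apply: ler_sum => H; rewrite powersetE => HD.
by rewrite ler_wpM2l ?fg // invr_ge0 exprn_ge0.
Qed.

Lemma eq_expectH (R : realType) (N d : nat) (f g : {set {set 'I_N}} -> R) :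
  (forall H : {set {set 'I_N}}, H \subset dsets N d -> f H = g H) -> expectH d f = expectH d g.
Proof. by move=> fg; apply: eq_bigr => H; rewrite powersetE => HD; rewrite fg. Qed.

Lemma expectHD (R : realType) (N d : nat) (f g : {set {set 'I_N}} -> R) :
  expectH d (fun H => f H + g H) = expectH d f + expectH d g.
Proof. by rewrite -big_split; apply: eq_bigr => H _; rewrite mulrDr. Qed.

Lemma expectHZ (R : realType) (N d : nat) (x : R) (f : {set {set 'I_N}} -> R) :
  expectH d (fun H => x * f H) = x * expectH d f.
Proof. by rewrite mulr_sumr; apply: eq_bigr => H _; rewrite mulrCA. Qed.

Lemma expectH_sum (R : realType) (N d : nat) (I : finType) (P : pred I)
    (f : I -> {set {set 'I_N}} -> R) :
  expectH d (fun H => \sum_(i | P i) f i H) = \sum_(i | P i) expectH d (f i).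
Proof. by rewrite exchange_big /=; apply: eq_bigr => H _; rewrite mulr_sumr. Qed.

Lemma expectH_subset (R : realType) (N d : nat) (F : {set {set 'I_N}}) :
  F \subset dsets N d -> expectH d (fun H => (F \subset H)%:R) = (2 ^+ #|F|)^-1 :> R.
Proof.
move=> FD; rewrite /expectH -mulr_sumr.
have -> : \sum_(H in powerset (dsets N d)) (F \subset H)%:R = 2 ^+ #|dsets N d :\: F| :> R.
  rewrite -natrX -card_supersets // -sum1_card natr_sum big_mkcond [RHS]big_mkcond.
  by apply: eq_bigr => H _; rewrite inE powersetE; do 2 case: (_ \subset _).
have n0 j : 2 ^+ j != 0 :> R by rewrite expf_neq0 // pnatr_eq0.
rewrite -(cardsID F (dsets N d)) (finset.setIidPr FD) exprD invfM mulfVK //.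
Qed.

Lemma expectH_const (R : realType) (N d : nat) (x : R) :
  expectH d (fun _ : {set {set 'I_N}} => x) = x.
Proof.
have := @expectH_subset R N d finset.set0 (finset.sub0set _).
rewrite cards0 expr0 invr1 => E; rewrite -[RHS]mulr1 -E -expectHZ.
by apply: eq_expectH => H _; rewrite finset.sub0set mulr1.
Qed.

Lemma clique_edges_dsets (N d : nat) (K : {set 'I_N}) : clique_edges d K \subset dsets N d.
Proof. by apply/fintype.subsetP => e; rewrite inE => /andP[]. Qed.

Lemma card_clique_edges (N d : nat) (K : {set 'I_N}) : #|clique_edges d K| = 'C(#|K|, d).
Proof. by rewrite -cards_draws; apply: eq_card => e; rewrite !inE andbC. Qed.

Lemma clique_edgesI (N d : nat) (A B : {set 'I_N}) :
  clique_edges d A :&: clique_edges d B = clique_edges d (A :&: B).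
Proof.
by apply/setP => e; rewrite !inE finset.subsetI; case: (#|e| == d); case: (e \subset A).
Qed.

Lemma is_clique_planted (N d : nat) (H : {set {set 'I_N}}) (S K : {set 'I_N}) :
  is_clique d (H :|: clique_edges d S) K = (clique_edges d K :\: clique_edges d S \subset H).
Proof. by rewrite is_cliqueE finset.subDset finset.setUC. Qed.

(** Edges inside [S] are certain, so only the edges of [K] not inside [S] cost a factor of one
    half. *)
Lemma expectH_clique (R : realType) (N d : nat) (S K : {set 'I_N}) :
  expectH d (fun H => (is_clique d (H :|: clique_edges d S) K)%:R) =
  (2 ^+ 'C(#|K|, d))^-1 * 2 ^+ 'C(#|K :&: S|, d) :> R.
Proof.
under eq_expectH do rewrite is_clique_planted.
rewrite expectH_subset; last first.
  exact: fintype.subset_trans (finset.subsetDl _ _) (clique_edges_dsets _ _).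
rewrite -(card_clique_edges d K) -(cardsID (clique_edges d S) (clique_edges d K)) clique_edgesI card_clique_edges.
by rewrite exprD invfM mulrAC mulVf ?mul1r // expf_neq0 // pnatr_eq0.
Qed.

(** Inclusion-exclusion: the edges inside the intersection are required only once. *)
Lemma expectH_two_cliques (R : realType) (N d : nat) (K K' : {set 'I_N}) :
  expectH d (fun H => (is_clique d H K)%:R * (is_clique d H K')%:R) =
  (2 ^+ 'C(#|K|, d))^-1 * ((2 ^+ 'C(#|K'|, d))^-1 * 2 ^+ 'C(#|K' :&: K|, d)) :> R.
Proof.
under eq_expectH do rewrite -natrM mulnb !is_cliqueE -finset.subUset.
rewrite expectH_subset; last by rewrite finset.subUset !clique_edges_dsets.
have := cardsUI (clique_edges d K) (clique_edges d K').
rewrite clique_edgesI !card_clique_edges finset.setIC => E.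
have n0 j : 2 ^+ j != 0 :> R by rewrite expf_neq0 // pnatr_eq0.
apply: (mulIf (n0 #|clique_edges d K :|: clique_edges d K'|)).
rewrite mulVf // -[RHS]mulrA -[X in _ = _ * X]mulrA [2 ^+ 'C(_, _) * 2 ^+ #|_|]mulrC.
by rewrite -exprD mulrA -invfM -exprD E mulVf.
Qed.

(** For disjoint [A] and [B], a subfamily of the edges of a clique [A :|: B] that is easy to count
    and avoids the edges of any [K] disjoint from [A]. *)
Definition star_edges (N e : nat) (A B : {set 'I_N}) : {set {set 'I_N}} :=
  (fun p : 'I_N * {set 'I_N} => p.1 |: p.2) @:
    finset.setX A [set f : {set 'I_N} | (f \subset B) && (#|f| == e)].

Lemma card_star_edges (N e : nat) (A B : {set 'I_N}) :
  [disjoint A & B] -> #|star_edges e A B| = (#|A| * 'C(#|B|, e))%N.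
Proof.
move=> AB; rewrite card_in_imset ?cardsX ?cards_draws //.
move=> [v f] [w g]; rewrite !inE /= => /andP[vA /andP[fB _]] /andP[wA /andP[gB _]] E.
have nB x : x \in A -> x \notin B by move=> xA; rewrite (disjointFr AB).
have vw : v = w.
  have : v \in w |: g by rewrite -E setU11.
  rewrite !inE => /predU1P[//|vg].
  by have := nB v vA; rewrite (fintype.subsetP gB).
rewrite -{w E}vw in wA E *; congr pair.
rewrite -[f](setU1K (a := v)) ?E ?setU1K //.
  by apply: contra (nB _ vA); exact: (fintype.subsetP gB).
by apply: contra (nB _ vA); exact: (fintype.subsetP fB).
Qed.

Lemma star_edges_sub (N e : nat) (A B : {set 'I_N}) :
  [disjoint A & B] -> star_edges e A B \subset clique_edges e.+1 (A :|: B).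
Proof.
move=> AB; apply/fintype.subsetP => _ /imsetP[[v f] + ->]; rewrite !inE /=.
move=> /andP[vA /andP[fB /eqP fe]]; rewrite cardsU1 fe.
have -> : v \notin f by apply: contra (negbT (disjointFr AB vA)); exact: (fintype.subsetP fB).
rewrite eqxx finset.subUset finset.sub1set inE vA /= (fintype.subset_trans fB) //.
exact: finset.subsetUr.
Qed.

Lemma star_edgesI (N e : nat) (S A B : {set 'I_N}) :
  star_edges e A B :&: clique_edges e.+1 S \subset star_edges e (A :&: S) (B :&: S).
Proof.
apply/fintype.subsetP => x; rewrite inE => /andP[/imsetP[[v f] vf ->]].
move: vf; rewrite !inE /= => /andP[vA /andP[fB fe]] /andP[_].
rewrite finset.subUset finset.sub1set => /andP[vS fS].
by apply/imsetP; exists (v, f); rewrite // !inE /= vA vS finset.subsetI fB fS fe.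
Qed.

(** Each star edge has a vertex outside [K], hence is independent of the edges of [K]. At most
    [#|A :&: S| * 'C(h, e)] star edges are planted, because [B :&: S] lies in [K :&: S]. *)
Lemma expectH_clique_extension (R : realType) (N e h : nat) (S K A B : {set 'I_N}) :
  [disjoint A & K] -> B \subset K -> (#|K :&: S| <= h)%N ->
  expectH e.+1 (fun H => (is_clique e.+1 (H :|: clique_edges e.+1 S) K)%:R *
                         (is_clique e.+1 (H :|: clique_edges e.+1 S) (A :|: B))%:R) <=
  ((2 ^+ 'C(#|K|, e.+1))^-1 * 2 ^+ 'C(#|K :&: S|, e.+1)) *
  ((2 ^+ (#|A| * 'C(#|B|, e)))^-1 * (2 ^+ 'C(h, e)) ^+ #|A :&: S|) :> R.
Proof.
move=> AK BK KS; have AB : [disjoint A & B] by exact: disjointWr BK AK.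
pose F1 := clique_edges e.+1 K :\: clique_edges e.+1 S.
pose F2 := star_edges e A B :\: clique_edges e.+1 S.
have F12 : F1 :&: F2 = finset.set0.
  apply/setP => x; rewrite !inE; apply/negP => /andP[/andP[_ /andP[_ xK]]] /andP[_].
  move=> /imsetP[[v f]]; rewrite !inE /= => /andP[vA _] xE.
  have : v \in K by apply: (fintype.subsetP xK); rewrite xE setU11.
  by rewrite (disjointFr AK).
have F2sub : F2 \subset clique_edges e.+1 (A :|: B) :\: clique_edges e.+1 S.
  by apply: finset.setSD; exact: star_edges_sub.
have Fd : F1 :|: F2 \subset dsets N e.+1.
  rewrite finset.subUset; apply/andP; split.
    exact: fintype.subset_trans (finset.subsetDl _ _) (clique_edges_dsets _ _).
  apply: fintype.subset_trans F2sub _.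
  exact: fintype.subset_trans (finset.subsetDl _ _) (clique_edges_dsets _ _).
apply: (@le_trans _ _ (expectH e.+1 (fun H => (F1 :|: F2 \subset H)%:R))).
  apply: le_expectH => H _; rewrite -natrM mulnb ler_nat !is_clique_planted finset.subUset.
  rewrite -/F1; case: (F1 \subset H) => //=.
  by case: (boolP (_ \subset H)) => // /(fintype.subset_trans F2sub) ->.
rewrite expectH_subset // cardsU F12 cards0 subn0 exprD invfM.
have n0 j : 2 ^+ j != 0 :> R by rewrite expf_neq0 // pnatr_eq0.
have -> : (2 ^+ #|F1|)^-1 = (2 ^+ 'C(#|K|, e.+1))^-1 * 2 ^+ 'C(#|K :&: S|, e.+1) :> R.
  rewrite -(card_clique_edges e.+1 K) -(cardsID (clique_edges e.+1 S) (clique_edges e.+1 K)) clique_edgesI.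
  by rewrite card_clique_edges exprD invfM mulrAC mulVf ?mul1r.
rewrite ler_wpM2l ?mulr_ge0 ?invr_ge0 ?exprn_ge0 //.
rewrite -card_star_edges // -(cardsID (clique_edges e.+1 S) (star_edges e A B)) -/F2.
set s := #|_ :&: _|; rewrite exprD invfM mulrAC -[leLHS]mul1r ler_wpM2r ?invr_ge0 ?exprn_ge0 //.
rewrite -[leLHS](mulVf (n0 s)) ler_wpM2l ?invr_ge0 ?exprn_ge0 // -exprM ler_eXn2l ?ltr1n //.
apply: leq_trans (subset_leq_card (star_edgesI e S A B)) _.
rewrite card_star_edges; last first.
  by apply: disjointWl (finset.subsetIl _ _) _; apply: disjointWr (finset.subsetIl _ _) AB.
rewrite mulnC leq_mul // leq_bin2l //; apply: leq_trans KS.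
by apply: subset_leq_card; exact: finset.setSI.
Qed.

Lemma card_kcliquesE (R : realType) (N d k : nat) (G : {set {set 'I_N}}) :
  #|kcliques d G k|%:R = \sum_(K : {set 'I_N} | #|K| == k) (is_clique d G K)%:R :> R.
Proof.
rewrite -sum1_card natr_sum big_mkcond [RHS]big_mkcond; apply: eq_bigr => K _.
by rewrite inE; case: (#|K| == k); case: is_clique.
Qed.

(** * First and second moments of cliques and gateways *)

Section Moments.
Variables (R : realType) (N e k : nat) (r : R).
Hypotheses (N0 : (0 < N)%N) (kN : (k <= N)%N) (r0 : 0 <= r) (r2 : r <= 1 / 2).

Let d := e.+1.
Let M : R := 'C(N, k)%:R * (2 ^+ 'C(k, d))^-1.

Let M0 : 0 < M.
Proof. by rewrite mulr_gt0 ?invr_gt0 ?exprn_gt0 // ltr0n bin_gt0. Qed.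

Let pow2_ge0 j : 0 <= 2 ^+ j :> R. Proof. by rewrite exprn_ge0. Qed.

Lemma sum_ksets_const (x : R) : \sum_(K : {set 'I_N} | #|K| == k) x = 'C(N, k)%:R * x.
Proof.
rewrite -[in RHS](card_ord N) -[in RHS](cardsT 'I_N) -cards_draws mulr_natl -sumr_const.
by apply: eq_bigl => K; rewrite inE finset.subsetT.
Qed.

Lemma expectH_kcliques :
  expectH d (fun H : {set {set 'I_N}} => #|kcliques d H k|%:R) = M.
Proof.
under eq_expectH do rewrite card_kcliquesE.
rewrite expectH_sum /M -sum_ksets_const; apply: eq_bigr => K /eqP Kk.
have := @expectH_clique R N d finset.set0 K; rewrite Kk finset.setI0 cards0 bin0n expr0 mulr1 => <-.
apply: eq_expectH => H _; suff -> : clique_edges d finset.set0 = finset.set0 by rewrite finset.setU0.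
by move=> n; apply/setP => f; rewrite !inE finset.subset0; apply/negP => /andP[+ /eqP fE];
   rewrite fE cards0.
Qed.

Hypothesis overlap : forall i, (i <= k)%N ->
  (k%:R * k%:R / N%:R) ^+ i * 2 ^+ 'C(i, d) <= r ^+ i.

(** Disjoint pairs contribute at most the squared mean; by [overlap], pairs with a common vertex add
    at most a fraction [2 * r] of it. *)
Lemma expectH_kcliques_sqr :
  expectH d (fun H : {set {set 'I_N}} => #|kcliques d H k|%:R ^+ 2) <= M ^+ 2 * (1 + 2 * r).
Proof.
rewrite (eq_expectH (g := fun H : {set {set 'I_N}} =>
  \sum_(K : {set 'I_N} | #|K| == k) \sum_(K' : {set 'I_N} | #|K'| == k)
    (is_clique d H K)%:R * (is_clique d H K')%:R)); last first.
  move=> H _; rewrite expr2 !card_kcliquesE mulr_suml.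
  by apply: eq_bigr => K _; rewrite mulr_sumr.
rewrite expectH_sum.
have -> : M ^+ 2 * (1 + 2 * r) = \sum_(K : {set 'I_N} | #|K| == k)
    (2 ^+ 'C(k, d))^-1 * ((2 ^+ 'C(k, d))^-1 * ('C(N, k)%:R * (1 + 2 * r))).
  by rewrite sum_ksets_const /M; ring.
apply: ler_sum => K /eqP Kk; rewrite expectH_sum.
rewrite (eq_bigr (fun K' : {set 'I_N} =>
   (2 ^+ 'C(k, d))^-1 * ((2 ^+ 'C(k, d))^-1 * 2 ^+ 'C(#|K' :&: K|, d)))); last first.
  by move=> K' /eqP K'k; rewrite expectH_two_cliques Kk K'k.
rewrite -2!mulr_sumr !ler_wpM2l ?invr_ge0 //.
rewrite (bigID (fun K' : {set 'I_N} => 1 <= #|K' :&: K|)%N) /= addrC mulrDr; apply: lerD.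
  rewrite -sum_ksets_const big_mkcondr /=; apply: ler_sum => K' _.
  by case: ifP => //; rewrite -eqn0Ngt => /eqP ->.
rewrite -[r in leRHS]expr1.
apply: (@sum_meet_geometric R N k 1 K (fun j => 2 ^+ 'C(j, d)) r) => // i ik.
by rewrite Kk; exact: overlap.
Qed.

(** Chebyshev's inequality: the variance is at most [2 * r * M ^+ 2] and the event forces a
    deviation of at least [M / 2]. *)
Lemma few_kcliques_rare :
  expectH d (fun H : {set {set 'I_N}} => (#|kcliques d H k|%:R < M / 2)%R%:R) <= 8 * r.
Proof.
have H2 : expectH d (fun H : {set {set 'I_N}} =>
     #|kcliques d H k|%:R ^+ 2 + ((- 2 * M) * #|kcliques d H k|%:R + M ^+ 2)) <= M ^+ 2 * (2 * r).
  rewrite !expectHD expectHZ expectH_const expectH_kcliques.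
  have := expectH_kcliques_sqr; lra.
rewrite -(ler_pM2l (_ : 0 < M ^+ 2 / 4)); last by rewrite divr_gt0 ?exprn_gt0.
rewrite -expectHZ; apply: le_trans (_ : M ^+ 2 * (2 * r) <= _); last by lra.
apply: le_trans H2; apply: le_expectH => H _.
set X : R := #|_|%:R.
rewrite (_ : X ^+ 2 + (- 2 * M * X + M ^+ 2) = (M - X) ^+ 2); last by ring.
case: ltP => XM; last by rewrite mulr0 sqr_ge0.
rewrite mulr1 (_ : M ^+ 2 / 4 = (M / 2) ^+ 2); last by field.
by rewrite lerXn2r // ?nnegrE; have := M0; lra.
Qed.

Variables (S : {set 'I_N}) (a b h : nat).
Hypothesis kab : k = (a + b)%N.
Hypothesis planted : forall i, (i <= k)%N ->
  (#|S|%:R * k%:R / N%:R) ^+ i * 2 ^+ 'C(i, d) <= r ^+ i.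
Hypothesis planted_ext : #|S|%:R * a%:R / N%:R * 2 ^+ 'C(h, e) <= 1 / 2 :> R.

Let weight (K : {set 'I_N}) : R := (2 ^+ 'C(k, d))^-1 * 2 ^+ 'C(#|K :&: S|, d).

Lemma sum_weight_le j :
  \sum_(K : {set 'I_N} | (#|K| == k) && (j <= #|K :&: S|)%N) weight K <= M * (2 * r ^+ j).
Proof.
rewrite -mulr_sumr /M [_%:R * _]mulrC -mulrA ler_wpM2l ?invr_ge0 //.
exact: (@sum_meet_geometric R N k j S (fun j => 2 ^+ 'C(j, d)) r).
Qed.

Lemma sum_extensions_le :
  \sum_(A : {set 'I_N} | #|A| == a) (2 ^+ 'C(h, e)) ^+ #|A :&: S| <= 'C(N, a)%:R * 2 :> R.
Proof.
have aN : (a <= N)%N by apply: leq_trans kN; rewrite kab leq_addr.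
have -> : 'C(N, a)%:R * 2 = 'C(N, a)%:R * (2 * (1 / 2) ^+ 0) :> R by rewrite expr0 mulr1.
rewrite (eq_bigl (fun A : {set 'I_N} => (#|A| == a) && (0 <= #|A :&: S|)%N)); last first.
  by move=> A; rewrite andbT.
apply: (@sum_meet_geometric R N a 0 S (fun j => (2 ^+ 'C(h, e)) ^+ j) (1 / 2) N0 aN).
- by move=> i; exact: exprn_ge0.
- lra.
- by [].
move=> i ia; by rewrite -exprMn lerXn2r ?nnegrE ?divr_ge0.
Qed.

(** Union bound. Large overlap with [S] gives the term in [r ^+ h]; otherwise one sums over [K], [A]
    and [B], with at most [2 ^+ k] choices of [B]. The sums over [K] and over [A] each lose a factor
    [2] to planted overlaps, whence the [4]. *)
Lemma expectH_gateways :
  expectH d (fun H => #|gateways d (H :|: clique_edges d S) S a b h|%:R) <=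
  M * (2 * r ^+ h + 4 * (2 ^+ k * (2 ^+ (a * 'C(b, e)))^-1 * 'C(N, a)%:R)).
Proof.
pose cl H K : R := (is_clique d (H :|: clique_edges d S) K)%:R.
apply: (@le_trans _ _ (expectH d (fun H =>
   \sum_(K : {set 'I_N} | (#|K| == k) && (h <= #|K :&: S|)%N) cl H K +
   \sum_(K : {set 'I_N} | (#|K| == k) && ~~ (h <= #|K :&: S|)%N)
   \sum_(A : {set 'I_N} | [disjoint A & K] && (#|A| == a))
   \sum_(B : {set 'I_N} | (B \subset K) && (#|B| == b)) cl H K * cl H (A :|: B)))).
  apply: le_expectH => H _; rewrite -sum1_card natr_sum.
  rewrite (eq_bigl (fun K : {set 'I_N} => (#|K| == k) && (K \in gateways d (H :|: clique_edges d S) S a b h))); last first.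
    by move=> K; rewrite !inE kab; case: (#|K| == _).
  rewrite (bigID (fun K : {set 'I_N} => h <= #|K :&: S|)%N) /=.
  have cl0 K : 0 <= cl H K by rewrite ler0n.
  apply: lerD.
    rewrite big_mkcond [leRHS]big_mkcond /=; apply: ler_sum => K _.
    rewrite /cl !inE kab; case: (#|K| == _) => //=.
    case: (h <= _)%N; rewrite ?andbF // !andbT.
    by case: is_clique => //=; case: ifP; rewrite ?lexx ?ler01.
  rewrite big_mkcond [leRHS]big_mkcond /=; apply: ler_sum => K _.
  rewrite !inE kab; case: (#|K| == _) => //=; rewrite /gateway.
  case: (leqP h) => //= _; first by rewrite andbF.
  rewrite andbT; case: ifP => [/andP[Kc]|_]; last first.
    by do 2 (apply: sumr_ge0 => ? _); rewrite mulr_ge0.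
  move=> /existsP[A /existsP[B /and5P[AK Aa BK Bb ABc]]].
  rewrite (bigD1 A) ?AK //= (bigD1 B) ?BK //= {1 2}/cl Kc ABc mulr1 -addrA lerDl.
  by rewrite addr_ge0 //; do ?(apply: sumr_ge0 => ? _); rewrite mulr_ge0.
rewrite expectHD mulrDr; apply: lerD.
  rewrite expectH_sum; apply: le_trans (sum_weight_le h); apply: ler_sum => K /andP[/eqP Kk _].
  by rewrite expectH_clique Kk.
rewrite expectH_sum.
set T := 2 ^+ k * _; have -> : M * (4 * (T * 'C(N, a)%:R)) = M * (2 * r ^+ 0) * (T * ('C(N, a)%:R * 2)).
  by rewrite expr0; ring.
have T0 : 0 <= T by rewrite mulr_ge0 ?invr_ge0.
apply: le_trans (ler_wpM2r _ (sum_weight_le 0)); last by rewrite !mulr_ge0.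
rewrite mulr_suml (eq_bigl (fun K : {set 'I_N} =>
   ((#|K| == k) && (0 <= #|K :&: S|)%N) && ~~ (h <= #|K :&: S|)%N)); last by move=> K; rewrite andbT.
have w0 K : 0 <= weight K by rewrite mulr_ge0 ?invr_ge0.
rewrite big_mkcondr /=; apply: ler_sum => K /andP[/eqP Kk _].
case: ifP => [hK|_]; last by rewrite mulr_ge0 // !mulr_ge0.
rewrite expectH_sum.
apply: (@le_trans _ _ (weight K * (T * \sum_(A : {set 'I_N} | #|A| == a) (2 ^+ 'C(h, e)) ^+ #|A :&: S|))); last first.
  by rewrite !ler_wpM2l // sum_extensions_le.
rewrite !mulr_sumr [leRHS](bigID (fun A : {set 'I_N} => [disjoint A & K])) /=.
apply: ler_wpDr; first by apply: sumr_ge0 => A _; rewrite !mulr_ge0 ?exprn_ge0.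
rewrite (eq_bigl (fun A : {set 'I_N} => (#|A| == a) && [disjoint A & K])); last by move=> A; rewrite andbC.
apply: ler_sum => A /andP[/eqP Aa AK].
rewrite expectH_sum.
apply: (@le_trans _ _ (\sum_(B in powerset K) weight K * ((2 ^+ (a * 'C(b, e)))^-1 * (2 ^+ 'C(h, e)) ^+ #|A :&: S|))); last first.
  by rewrite sumr_const card_powerset Kk -[leLHS]mulr_natl natrX /T; lra.
rewrite big_mkcond [leRHS]big_mkcond /=; apply: ler_sum => B _; rewrite powersetE.
case: (boolP (B \subset K)) => //= BK.
case: eqP => [Bb|_]; last by rewrite !mulr_ge0 ?invr_ge0 ?exprn_ge0.
have := @expectH_clique_extension R N e h S K A B AK BK.
rewrite Kk Aa Bb; apply; rewrite leqNgt; apply/negP => /ltnW; exact/negP.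
Qed.
End Moments.

Lemma kcliquesS (N d k : nat) (G G' : {set {set 'I_N}}) :
  G \subset G' -> kcliques d G k \subset kcliques d G' k.
Proof.
move=> GG'; apply/fintype.subsetP => K; rewrite !inE !is_cliqueE => /andP[-> /=] KG.
exact: fintype.subset_trans KG GG'.
Qed.

(** Two bad events are discarded: fewer than [M / 2] cliques (Chebyshev) and at least [M * rho]
    gateways (Markov). Outside them the counts satisfy [gateway_bottleneck], for all [lam] at once
    since they do not involve [lam]. *)
Lemma slow_hitting_probability (R : realType) (N e : nat) (S : {set 'I_N}) (m : int)
    (a b h t : nat) (r rho : R) :
  (0 < N)%N -> (a + b <= N)%N -> (0 < a)%N -> (a + b + a)%:Z <= m ->
  0 <= r -> r <= 1 / 2 -> 0 < rho -> (2 * t%:R + 1) * rho <= 1 / 2 ->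
  (forall i, (i <= a + b)%N ->
     ((a + b)%:R * (a + b)%:R / N%:R) ^+ i * 2 ^+ 'C(i, e.+1) <= r ^+ i) ->
  (forall i, (i <= a + b)%N ->
     (#|S|%:R * (a + b)%:R / N%:R) ^+ i * 2 ^+ 'C(i, e.+1) <= r ^+ i) ->
  #|S|%:R * a%:R / N%:R * 2 ^+ 'C(h, e) <= 1 / 2 :> R ->
  1 - (8 * r + (2 * r ^+ h +
     4 * (2 ^+ (a + b) * (2 ^+ (a * 'C(b, e)))^-1 * 'C(N, a)%:R)) / rho) <=
  expectH e.+1 (fun H => if `[< forall lam : R, 1 < lam ->
     exists K0 : {set 'I_N}, is_clique e.+1 (H :|: clique_edges e.+1 S) K0 /\
       ((t.+1%:R / 2)%:E <=
          expected_hitting_time e.+1 (H :|: clique_edges e.+1 S) lam m K0)%E >]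
     then 1 else 0).
Proof.
move=> N0 kN a0 km r0 r2 rho0 trho overlap planted ext.
set d := e.+1; set k := (a + b)%N.
pose M : R := 'C(N, k)%:R * (2 ^+ 'C(k, d))^-1.
have M0 : 0 < M by rewrite mulr_gt0 ?invr_gt0 ?exprn_gt0 // ltr0n bin_gt0.
pose X (H : {set {set 'I_N}}) : R := #|kcliques d H k|%:R.
pose Y (H : {set {set 'I_N}}) : R := #|gateways d (H :|: clique_edges d S) S a b h|%:R.
have XE := few_kcliques_rare N0 kN r0 r2 overlap.
have YE := expectH_gateways N0 kN r0 r2 (erefl _) planted ext.
apply: (@le_trans _ _ (expectH d (fun H =>
    1 + ((-1) * (X H < M / 2)%R%:R + (- (M * rho)^-1) * Y H)))); last first.
  apply: le_expectH => H _; have Y0 : 0 <= Y H by rewrite ler0n.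
  have Y0' : 0 <= (M * rho)^-1 * Y H by rewrite mulr_ge0 // invr_ge0 ltW // mulr_gt0.
  case: ltP => XM /=; first by case: ifP => _; lra.
  have [YM|YM] := leP (M * rho) (Y H).
    have : 1 <= (M * rho)^-1 * Y H by rewrite mulrC ler_pdivlMr ?mul1r // mulr_gt0.
    by case: ifP => _; lra.
  rewrite asboolT; first by lra.
  move=> lam lam1; set G := H :|: _.
  (* Planting only adds cliques, so a lower bound on the count in [H] suffices. *)
  have XG : X H <= #|kcliques d G k|%:R.
    by rewrite ler_nat; apply: subset_leq_card; apply: kcliquesS; exact: finset.subsetUl.
  have sub : gateways d G S a b h \subset kcliques d G k.
    by apply/fintype.subsetP => K; rewrite inE => /andP[].
  have cE : #|kcliques d G k :\: gateways d G S a b h|%:R = #|kcliques d G k|%:R - Y H.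
    by rewrite cardsD (finset.setIidPr sub) natrB // subset_leq_card.
  have YM' : (2 * t%:R + 1) * Y H < M / 2.
    have [Yz|Yp] := eqVneq (Y H) 0; first by rewrite Yz mulr0 divr_gt0.
    have t0 : 0 <= t%:R :> R by [].
    apply: lt_le_trans (_ : (2 * t%:R + 1) * (M * rho) <= _).
      by rewrite ltr_pM2l //; lra.
    by rewrite mulrCA ler_pM2l //; lra.
  apply: (@gateway_bottleneck R N d G lam m S a b h t lam1 N0 a0 km).
    rewrite -(ltr_nat R) cE; have : 0 <= t%:R * Y H by rewrite mulr_ge0.
    lra.
  rewrite -(ler_nat R) cE !natrM -/(Y H); lra.
rewrite expectHD expectHD !expectHZ expectH_const.
set B := 2 * r ^+ h + _ in YE *.
have : (M * rho)^-1 * expectH d Y <= B / rho.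
  rewrite [leLHS]mulrC (ler_pdivrMr _ _ (mulr_gt0 M0 rho0)).
  by rewrite (_ : B / rho * (M * rho) = M * B) //; field; exact: lt0r_neq0.
move: XE; rewrite -/M -/d -/k -/(X _) => XE; lra.
Qed.

Lemma card_ksets_gt0 (N k : nat) :
  (k <= N)%N -> (0 < #|[set S : {set 'I_N} | #|S| == k]|)%N.
Proof.
move=> kN; have [S _ Sk] : exists2 S : {set 'I_N}, S \subset [set: 'I_N] & #|S| = k.
  by apply: exists_subset_card; rewrite cardsT card_ord.
by apply/card_gt0P; exists S; rewrite inE Sk.
Qed.

Lemma probG_ge (R : realType) (N d kap : nat) (P : {set {set 'I_N}} -> Prop) (x : R) :
  (kap <= N)%N ->
  (forall S : {set 'I_N}, #|S| = kap ->
     x <= expectH d (fun H => if `[< P (H :|: clique_edges d S) >] then 1 else 0)) ->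
  x <= @probG R N d kap P.
Proof.
move=> kN H; rewrite /probG mulrC ler_pdivlMr ?ltr0n ?card_ksets_gt0 // mulr_natr -sumr_const.
rewrite (eq_bigl (fun S : {set 'I_N} => #|S| == kap)); last by move=> S; rewrite inE.
by apply: ler_sum => S /eqP /H.
Qed.

Lemma probG_le1 (R : realType) (N d kap : nat) (P : {set {set 'I_N}} -> Prop) :
  (kap <= N)%N -> @probG R N d kap P <= 1.
Proof.
move=> kN; rewrite /probG mulrC ler_pdivrMr ?ltr0n ?card_ksets_gt0 // mul1r.
rewrite [leRHS](_ : _ = \sum_(S : {set 'I_N} | #|S| == kap) 1); last first.
  by rewrite -sumr_const; apply: eq_bigl => S; rewrite inE.
apply: ler_sum => S _; rewrite -[leRHS](@expectH_const R N d 1).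
by apply: le_expectH => H _; case: ifP.
Qed.

(** * Asymptotic estimates *)

Lemma exp_le_ffact (n i : nat) : ((n - i) ^ i <= n ^_ i)%N.
Proof.
elim: i => [|i IH]; first by rewrite ffactn0.
rewrite ffactnSr expnSr leq_mul ?leq_sub2l //; apply: leq_trans IH.
by case: (posnP i) => [->|i0]; rewrite ?expn0 ?leq_exp2r //; lia.
Qed.

Lemma expr_two (R : realType) (j : nat) : 2 ^+ j = expR (j%:R * ln 2) :> R.
Proof. by rewrite expRM_natl lnK ?posrE. Qed.

Lemma ln2_bounds (R : realType) : 0 < ln 2 :> R /\ ln 2 <= 1 :> R.
Proof.
split; first by rewrite ln_gt0 // ltr1n.
by have := @le_ln1Dx R 1 (lt_trans (ltrN10 R) ltr01).
Qed.

(** The exponential is the square of [expR (c * n / 2)], which is at least [c * n / 2]; the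
    threshold on [n] makes the square of the latter at least [C * n]. *)
Lemma linear_le_expR (R : realType) (c C n : R) :
  0 < c -> 0 <= C -> 4 * C / c ^+ 2 <= n -> C * n <= expR (c * n).
Proof.
move=> c0 C0 nC; have n0 : 0 <= n.
  by apply: le_trans nC; rewrite divr_ge0 ?sqr_ge0 // mulr_ge0.
have -> : c * n = c * n / 2 + c * n / 2 by field.
rewrite expRD; apply: (@le_trans _ _ ((c * n / 2) * (c * n / 2))).
  move: nC; rewrite ler_pdivrMr ?exprn_gt0 // => nC.
  have -> : c * n / 2 * (c * n / 2) = n * c ^+ 2 * n / 4 by field.
  rewrite ler_pdivlMr //; have -> : C * n * 4 = 4 * C * n by ring.
  by rewrite ler_wpM2r.
have z0 : 0 <= c * n / 2 by rewrite divr_ge0 // mulr_ge0 // ltW.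
by apply: ler_pM => //; apply: le_trans (expR_ge1Dx _); rewrite lerDr.
Qed.

Lemma exists_exponent_slack (R : realType) (e : nat) (s : R) :
  0 < s -> exists2 tau : R, 0 < tau <= 1 / 4 & (1 + 4 * tau) ^+ e <= 1 + s.
Proof.
(* A crude converse of Bernoulli's inequality on the unit interval; it allows [4 * tau] to be the
   minimum of [1] and [s / 3 ^+ e]. *)
move=> s0; have bern (z : R) : 0 <= z -> z <= 1 -> (1 + z) ^+ e <= 1 + 3 ^+ e * z.
  move=> z0 z1; elim: e => [|j IH]; first by rewrite !expr0; lra.
  rewrite exprSr; apply: le_trans (ler_wpM2r _ IH) _; first by lra.
  have t1 : 1 <= 3 ^+ j :> R by rewrite exprn_ege1 // ler1n.
  rewrite exprS; set t := 3 ^+ j in t1 *.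
  have : 0 <= t * z * (1 - z) by rewrite !mulr_ge0 //; lra.
  have : 0 <= (t - 1) * z by rewrite mulr_ge0 //; lra.
  nra.
have t0 : 0 < 3 ^+ e :> R by rewrite exprn_gt0.
pose z := Order.min 1 (s / 3 ^+ e).
have z0 : 0 < z by rewrite lt_min ltr01 divr_gt0.
have z1 : z <= 1 by rewrite ge_min lexx.
have zs : 3 ^+ e * z <= s by rewrite mulrC -ler_pdivlMr // ge_min lexx orbT.
exists (z / 4); first by apply/andP; split; lra.
have -> : 4 * (z / 4) = z by field.
by apply: le_trans (bern _ (ltW z0) z1) _; lra.
Qed.

Lemma ltB1_truncn (R : realType) (x : R) : x - 1 < (Num.truncn x)%:R.
Proof. by rewrite ltrBlDr natr1 truncnS_gt. Qed.

(** * Estimates at the critical clique size *)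

Section Scale.
Variables (R : realType) (e N : nat) (tau beta gamma n y : R).
Hypotheses (e0 : (0 < e)%N) (NE : N%:R = expR n).
Hypotheses (tau0 : 0 < tau) (tau4 : tau <= 1 / 4) (slack : (1 + 4 * tau) ^+ e <= 1 + 2 * gamma).
Hypotheses (gammaE : gamma = (1 - 2 * beta) / 4) (gamma0 : 0 < gamma) (beta0 : 0 < beta).
Hypotheses (y_tau : 2 * e.+1%:R <= tau * y) (yE : y ^+ e * ln 2 = e`!%:R * n).

Let e1 : 1 <= e%:R :> R. Proof. by rewrite ler1n. Qed.
Let fact0 : 0 < e`!%:R :> R. Proof. by rewrite ltr0n fact_gt0. Qed.
Let ytau : 2 * (e%:R + 1) <= tau * y. Proof. by rewrite natr1. Qed.

Lemma scale_ge : 16 <= y.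
Proof. have := e1; have := ytau; move: tau0 tau4; nra. Qed.

Let y0 : 0 < y. Proof. have := scale_ge; lra. Qed.
Let n0 : 0 <= n.
Proof.
rewrite -(pmulr_rge0 _ fact0) -yE mulr_ge0 ?exprn_ge0 ?(ltW y0) //.
by have [/ltW] := ln2_bounds R.
Qed.

(** By [yE], [y ^+ e] over the factorial of [e] is the binary logarithm of [N]; the falling
    factorial of [j] is compared with [j ^ e]. *)
Lemma bin_scale_upper (c : R) j : 0 <= c -> j%:R <= c * y -> 'C(j, e)%:R * ln 2 <= c ^+ e * n.
Proof.
move=> c0 jc; rewrite -(ler_pM2l fact0) [leRHS]mulrCA -yE [leRHS]mulrA -exprMn mulrA.
rewrite ler_wpM2r //; first by have [/ltW] := ln2_bounds R.
rewrite -natrM mulnC bin_ffact; apply: (@le_trans _ _ (j ^ e)%:R).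
  by rewrite ler_nat ffact_le_exp.
by rewrite natrX lerXn2r ?nnegrE // mulr_ge0 // ltW.
Qed.

Lemma bin_scale_lower (c : R) j : 0 <= c -> c * y <= j%:R - e%:R ->
  c ^+ e * n <= 'C(j, e)%:R * ln 2.
Proof.
move=> c0 cj; rewrite -(ler_pM2l fact0) [leLHS]mulrCA -yE [leLHS]mulrA -exprMn [leRHS]mulrA.
have cy : 0 <= c * y by rewrite mulr_ge0 // ltW.
rewrite ler_wpM2r //; first by have [/ltW] := ln2_bounds R.
have ej : (e <= j)%N by rewrite -(ler_nat R); lra.
rewrite -natrM mulnC bin_ffact; apply: (@le_trans _ _ ((j - e) ^ e)%:R).
  by rewrite natrX natrB // lerXn2r ?nnegrE //; lra.
by rewrite ler_nat exp_le_ffact.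
Qed.

Let k : nat := Num.truncn ((1 + 2 * tau) * y).
Let b : nat := Num.truncn ((1 + tau) * y).
(** Small enough that [2 ^+ 'C(h, e)] is at most [N ^ (1/4)], yet proportional to [y], so that
    [r ^+ h] is [N] to a negative multiple of [y]. *)
Let h : nat := Num.truncn (1 / 4 * y).

Let k_le : k%:R <= (1 + 2 * tau) * y.
Proof. by rewrite truncn_le mulr_ge0 ?(ltW y0) //; move: tau0; lra. Qed.
Let k_gt : (1 + 2 * tau) * y - 1 < k%:R.
Proof. exact: ltB1_truncn. Qed.
Let b_le : b%:R <= (1 + tau) * y.
Proof. by rewrite truncn_le mulr_ge0 ?(ltW y0) //; move: tau0; lra. Qed.
Let b_gt : (1 + tau) * y - 1 < b%:R.
Proof. exact: ltB1_truncn. Qed.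

Lemma core_lt_clique_size : (b < k)%N.
Proof. by rewrite -(ltr_nat R); have := e1; have := ytau; have := b_le; have := k_gt; lra. Qed.

(** Rounding is absorbed by [tau * y >= 4]; the [- 1] is kept for the ceilings in the target
    size. *)
Lemma gap_bounds : tau * y / 2 <= (k - b)%:R :> R /\ k%:R + (k - b)%:R <= (1 + 4 * tau) * y - 1.
Proof.
rewrite natrB; last exact: ltnW core_lt_clique_size.
have := e1; have := ytau; have := b_le; have := k_gt; have := k_le; have := b_gt.
by split; lra.
Qed.

Lemma clique_size_le : k%:R <= 2 * y.
Proof. have := k_le; have := y0; move: tau0 tau4; nra. Qed.

Lemma planted_part_bounds : y / 8 <= h%:R /\ 'C(h, e)%:R * ln 2 <= n / 4.
Proof.
split.
  by have := ltB1_truncn (1 / 4 * y); rewrite -/h; have := scale_ge; lra.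
have h4 : h%:R <= 1 / 4 * y by rewrite truncn_le; have := y0; lra.
apply: le_trans (@bin_scale_upper (1 / 4) h _ h4) _; first by lra.
rewrite [leRHS]mulrC ler_wpM2r //; case: e e0 => // j _; rewrite exprS.
rewrite [leRHS](_ : _ = 1 / 4 * 1); last by lra.
have q0 : 0 <= 1 / 4 :> R by lra.
have q1 : 1 / 4 <= 1 :> R by lra.
by apply: ler_pM => //; exact: exprn_ile1.
Qed.

(** From [(e + 1) 'C(i, e + 1) = i 'C(i - 1, e)] and [e + 1 >= 2], each vertex accounts for at most
    half of ['C(k, e)] edges, a factor near [N ^ (1/2)]. The threshold [1/2] for [beta] originates
    here. *)
Lemma pow2_bin_le i : (i <= k)%N -> 2 ^+ 'C(i, e.+1) <= expR ((1 + 2 * gamma) / 2 * n) ^+ i.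
Proof.
move=> ik; rewrite expr_two -expRM_natl ler_expR.
have H : 'C(k, e)%:R * ln 2 <= (1 + 2 * gamma) * n.
  apply: le_trans (@bin_scale_upper (1 + 2 * tau) k _ k_le) _; first by move: tau0; lra.
  rewrite ler_wpM2r //; apply: le_trans slack.
  by rewrite lerXn2r ?nnegrE //; move: tau0; lra.
have i0 : 0 <= i%:R :> R by [].
have E : e.+1%:R * 'C(i, e.+1)%:R <= i%:R * 'C(k, e)%:R :> R.
  rewrite -!natrM ler_nat -mul_bin_diag leq_mul // leq_bin2l //.
  exact: leq_trans (leq_pred _) ik.
have [l0 l1] := ln2_bounds R.
have c0 : 0 <= 'C(i, e.+1)%:R :> R by [].
rewrite -[e.+1%:R]natr1 in E.
have : (1 + 1) * 'C(i, e.+1)%:R <= i%:R * 'C(k, e)%:R :> R.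
  apply: le_trans E; rewrite ler_wpM2r //; have := e1; lra.
move/(ler_wpM2r (ltW l0)) => E2.
have := ler_wpM2l i0 H; lra.
Qed.

(** Per common vertex the exponents of [N] are [beta], [gamma / 2], [- 1] and [(1 + 2 gamma) / 2];
    the choice of [gamma] makes them add up to [- gamma / 2]. *)
Lemma overlap_bound (s : R) i : 0 <= s -> s <= expR (beta * n) ->
  k%:R <= expR (gamma / 2 * n) -> (i <= k)%N ->
  (s * k%:R / N%:R) ^+ i * 2 ^+ 'C(i, e.+1) <= expR (- (gamma / 2 * n)) ^+ i.
Proof.
move=> s0 sb kg ik.
apply: (@le_trans _ _ ((s * k%:R / N%:R) ^+ i * expR ((1 + 2 * gamma) / 2 * n) ^+ i)).
  by rewrite ler_wpM2l ?pow2_bin_le // exprn_ge0 // divr_ge0 // mulr_ge0.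
have -> : - (gamma / 2 * n) = beta * n + gamma / 2 * n + - n + (1 + 2 * gamma) / 2 * n.
  by rewrite gammaE; field.
rewrite [in leRHS]expRD -exprMn lerXn2r ?nnegrE //.
  by rewrite mulr_ge0 ?expR_ge0 // divr_ge0 // mulr_ge0.
rewrite ler_wpM2r ?expR_ge0 // !expRD expRN -NE ler_wpM2r ?invr_ge0 //.
exact: ler_pM.
Qed.

Lemma planted_extension_bound (s : R) : 0 <= s -> s <= expR (beta * n) ->
  k%:R <= expR (gamma / 2 * n) -> 8 <= n ->
  s * (k - b)%:R / N%:R * 2 ^+ 'C(h, e) <= 1 / 2.
Proof.
move=> s0 sb kg n8.
apply: (@le_trans _ _ (expR (beta * n) * expR (gamma / 2 * n) / N%:R * expR (n / 4))).
  apply: ler_pM; rewrite ?exprn_ge0 ?divr_ge0 ?mulr_ge0 //.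
    rewrite ler_wpM2r ?invr_ge0 //; apply: ler_pM => //; apply: le_trans kg.
    by rewrite ler_nat leq_subr.
  by rewrite expr_two ler_expR; case: planted_part_bounds.
rewrite NE -expRN -!expRD.
apply: (@le_trans _ _ (expR (- 1))).
  (* The exponents of [N] add up to [- 1/4 - 3 gamma / 2]. *)
  by rewrite ler_expR; move: n8 beta0 gamma0 gammaE; nra.
rewrite expRN div1r lef_pV2 ?posrE ?expR_gt0 //.
by apply: le_trans (expR_ge1Dx _); lra.
Qed.

(** Each of the [a] new vertices has [N] choices but costs [N ^ (1 + tau / 2)] in edges. As
    [a >= tau * y / 2], the net gain is [N ^ (- tau ^ 2 * y / 4)], half of which pays for
    [2 ^+ k]. *)
Lemma extension_count_bound (c : R) : c <= tau ^+ 2 / 8 -> 16 <= tau ^+ 2 * n ->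
  2 ^+ k * (2 ^+ ((k - b) * 'C(b, e)))^-1 * 'C(N, k - b)%:R <= expR (- (c * n * y)).
Proof.
move=> ct tn; have [l0 l1] := ln2_bounds R; have [g1 g2] := gap_bounds.
set a := (k - b)%N in g1 g2 *.
have a0 : 0 <= a%:R :> R by [].
have Cb : (1 + tau / 2) * n <= 'C(b, e)%:R * ln 2.
  apply: (@le_trans _ _ ((1 + tau / 2) ^+ e * n)).
    rewrite ler_wpM2r //; case: e e0 => // j _; rewrite exprS ler_peMr //; first by move: tau0; lra.
    by rewrite exprn_ege1 //; move: tau0; lra.
  (* The losses of [e] and of [1] from rounding are covered by [tau * y / 2 >= e + 1]. *)
  apply: bin_scale_lower; first by move: tau0; lra.
  by have := b_gt; have := ytau; lra.
apply: (@le_trans _ _ (expR (k%:R * ln 2) * expR (- (a%:R * ((1 + tau / 2) * n))) * expR (a%:R * n))).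
  apply: ler_pM; rewrite ?mulr_ge0 ?invr_ge0 ?exprn_ge0 //.
    rewrite expr_two ler_wpM2l ?expR_ge0 // expr_two -expRN ler_expR lerN2 natrM -mulrA.
    by rewrite ler_wpM2l.
  by rewrite expRM_natl -NE -natrX ler_nat bin_le_exp.
rewrite -!expRD ler_expR.
have kl : k%:R * ln 2 <= 2 * y.
  by apply: le_trans clique_size_le; rewrite ler_piMr.
have : 16 * y <= tau ^+ 2 * n * y by rewrite ler_wpM2r // ltW.
have : c * (n * y) <= tau ^+ 2 / 8 * (n * y) by rewrite ler_wpM2r // mulr_ge0 // ltW.
have : tau * y / 2 * (tau / 2 * n) <= a%:R * (tau / 2 * n).
  by rewrite ler_wpM2r // mulr_ge0 // divr_ge0 // ltW.
lra.
Qed.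

End Scale.

(** With [u] and [v] the two roots, [u >= v] because half the factorial of [e + 1] is at least that
    of [e]. Hence the target exceeds [2 * u - v - 1 >= v - 1], and the slack makes [v] large
    enough. *)
Lemma target_size_ge (R : realType) (e N j : nat) (eps tau : R) :
  (0 < e)%N -> 0 < eps -> 0 < tau -> (1 + 4 * tau) ^+ e <= 1 + 2 / 3 * eps ->
  0 <= log2 N%:R :> R ->
  j%:R <= (1 + 4 * tau) * (e`!%:R * log2 N%:R) `^ (e%:R)^-1 - 1 ->
  j%:Z <= target_size e.+1 N eps.
Proof.
move=> e0 eps0 tau0 slack L0 jy; rewrite /target_size /=.
move: (log2 _) L0 jy => L L0 jy; set u := (_ * _ * L) `^ _; set v := (_ * _ * L) `^ _.
have s0 : 0 <= 1 + 2 / 3 * eps by lra.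
have f0 : 0 <= e`!%:R :> R by [].
have ie0 : 0 <= (e%:R : R)^-1 by rewrite invr_ge0.
have uv : v <= u.
  apply: ge0_ler_powR; rewrite ?nnegrE ?mulr_ge0 ?divr_ge0 //.
  rewrite ler_wpM2r // ler_wpM2l // ler_pdivlMr // -natrM ler_nat factS mulnC.
  by rewrite leq_mul2r ltnS e0 orbT.
have vy : (1 + 4 * tau) * (e`!%:R * L) `^ (e%:R)^-1 <= v.
  have -> : 1 + 4 * tau = ((1 + 4 * tau) ^+ e) `^ (e%:R)^-1.
    rewrite -powR_mulrn; last by lra.
    by rewrite -powRrM mulfV ?pnatr_eq0 -?lt0n // powRr1 //; lra.
  rewrite -powRM ?mulr_ge0 ?exprn_ge0 //; last by lra.
  apply: ge0_ler_powR; rewrite ?nnegrE ?mulr_ge0 ?exprn_ge0 //; first by lra.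
  by rewrite mulrA ler_wpM2r // ler_wpM2r.
rewrite -(ler_int R) rmorphB rmorphM /=.
have := ceil_itv v => /andP[+ _]; rewrite rmorphB /= => hv.
have := ceil_itv u => /andP[_ hu].
have -> : (j%:Z)%:~R = j%:R :> R by [].
lra.
Qed.

(* The scale is [y = (e! log2 N)^(1/e)], the clique size at which a clique has
   about one extending vertex in the whole graph.  Cliques of size
   [k = (1 + 2 tau) y] still abound, but a set of [b = (1 + tau) y] of their
   vertices is extended by a given number [a] of vertices with probability at
   most [N ^ (- a tau / 2)], and [k + a], about [(1 + 3 tau) y], is at most the target. *)
Lemma planted_slow_probability (R : realType) (e N : nat) (eps beta tau gamma c n y : R) :
  n = ln N%:R -> y = (e`!%:R * log2 N%:R) `^ (e%:R)^-1 ->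
  (0 < e)%N -> (0 < N)%N -> 0 < eps -> 0 < tau -> tau <= 1 / 4 ->
  (1 + 4 * tau) ^+ e <= 1 + 2 * gamma -> (1 + 4 * tau) ^+ e <= 1 + 2 / 3 * eps ->
  gamma = (1 - 2 * beta) / 4 -> 0 < gamma -> 0 < beta ->
  y ^+ e * ln 2 = e`!%:R * n -> 2 * e.+1%:R <= tau * y ->
  2 * y <= expR (beta * n) -> 2 * y <= expR (gamma / 2 * n) ->
  16 <= tau ^+ 2 * n -> 2 <= gamma * n -> 64 <= c * n ->
  0 < c -> c <= gamma / 16 -> c <= tau ^+ 2 / 8 ->
  (kappa N beta <= N)%N /\
  1 - 14 * expR (- (c / 2 * n)) <=
  @probG R N e.+1 (kappa N beta)
    (fun G => forall lam : R, 1 < lam ->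
       exists K0 : {set 'I_N}, is_clique e.+1 G K0 /\
         (((N%:R : R) `^ (c / 4 * (log2 N%:R) `^ (e%:R)^-1))%:E
            < expected_hitting_time e.+1 G lam (target_size e.+1 N eps) K0)%E).
Proof.
move=> nE yE e0 N0 eps0 tau0 tau4 slack slack2 gammaE gamma0 beta0 ye ytau yb yg tn gn cn c0 cg ct.
have NE : N%:R = expR n by rewrite nE lnK // posrE ltr0n.
have y16 := scale_ge e0 tau0 tau4 ytau.
have [l0 l1] := ln2_bounds R.
have n8 : 8 <= n.
  have : tau ^+ 2 <= 1 by rewrite exprn_ile1 // ?(ltW tau0) //; lra.
  have n0 : 0 < n.
    by have : 0 < tau ^+ 2 * n by [lra]; rewrite pmulr_rgt0 // exprn_gt0.
  by move=> t1; have : tau ^+ 2 * n <= 1 * n; [rewrite ler_wpM2r // ltW|lra].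
have n0 : 0 <= n by lra.
have ny : n <= n * y by rewrite ler_peMr //; lra.
have L0 : 0 <= log2 N%:R :> R by rewrite /log2 -nE divr_ge0 // ltW.
set k := Num.truncn ((1 + 2 * tau) * y); set b := Num.truncn ((1 + tau) * y).
set h := Num.truncn (1 / 4 * y); set a := (k - b)%N.
have k2 : k%:R <= 2 * y := clique_size_le e0 tau0 tau4 ytau.
have kb := le_trans k2 yb; have kg := le_trans k2 yg.
have NbE : (N%:R : R) `^ beta = expR (beta * n).
  by rewrite /powR pnatr_eq0 gtn_eqF // -nE.
have kapb : (kappa N beta)%:R <= expR (beta * n).
  by rewrite /kappa NbE truncn_le expR_ge0.
have bN : expR (beta * n) <= N%:R.
  by rewrite NE ler_expR ler_piMl //; move: gamma0; rewrite gammaE; lra.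
have kapN : (kappa N beta <= N)%N by rewrite -(ler_nat R); exact: le_trans bN.
split => //.
have bk : (b < k)%N := core_lt_clique_size e0 tau0 tau4 ytau.
have ka : (a + b = k)%N by rewrite subnK // ltnW.
have kN : (k <= N)%N by rewrite -(ler_nat R); apply: le_trans bN.
have [g1 g2] := gap_bounds e0 tau0 tau4 ytau.
have [h8 hC] := planted_part_bounds e0 tau0 tau4 ytau ye.
pose z := c / 2 * n * y.
have zE : z = c / 2 * n * y by [].
have z32 : 32 <= z.
  have : c / 2 * n <= c / 2 * (n * y) by rewrite ler_wpM2l // ltW // divr_gt0.
  rewrite zE; lra.
(* Half of the exponent in the gateway bound; the other half is left for Markov's inequality. *)
pose rho := expR (- z).
have rho0 : 0 < rho by rewrite expR_gt0.
have rho4 : rho <= 1 / 4.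
  rewrite /rho expRN div1r lef_pV2 ?posrE ?expR_gt0 //.
  by apply: le_trans (expR_ge1Dx _); lra.
(* Then [2 * t * rho] and [rho] are each at most [1 / 4]. *)
pose t := Num.truncn ((8 * rho)^-1).
have t_le : t%:R <= (8 * rho)^-1 by rewrite truncn_le invr_ge0 mulr_ge0 // ltW.
have trho : (2 * t%:R + 1) * rho <= 1 / 2.
  have : t%:R * (8 * rho) <= 1 by rewrite -ler_pdivlMr ?div1r // mulr_gt0.
  lra.
pose r := expR (- (gamma / 2 * n)).
have r0 : 0 <= r by rewrite expR_ge0.
have r2 : r <= 1 / 2.
  rewrite /r expRN div1r lef_pV2 ?posrE ?expR_gt0 //.
  by apply: le_trans (expR_ge1Dx _); lra.
apply: probG_ge => // S Sk.
have := @slow_hitting_probability R N e S (target_size e.+1 N eps) a b h t r rho N0.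
rewrite ka => /(_ kN); rewrite subn_gt0 => /(_ bk).
have km : (k + a)%:Z <= target_size e.+1 N eps.
  by apply: (target_size_ge e0 eps0 tau0 slack2 L0); rewrite natrD -yE.
move=> /(_ km r0 r2 rho0 trho) H.
have ov s i : 0 <= s -> s <= expR (beta * n) -> (i <= k)%N ->
    (s * k%:R / N%:R) ^+ i * 2 ^+ 'C(i, e.+1) <= r ^+ i.
  by move=> s0 sb ik; apply: (@overlap_bound R e N tau beta gamma n y).
have Sb : #|S|%:R <= expR (beta * n) by rewrite Sk.
have ext : #|S|%:R * a%:R / N%:R * 2 ^+ 'C(h, e) <= 1 / 2 :> R.
  by apply: (@planted_extension_bound R e N tau beta gamma n y).
have {}H := H (fun i => ov k%:R i (ler0n _ _) kb) (fun i => ov #|S|%:R i (ler0n _ _) Sb) ext.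
have T := extension_count_bound e0 NE tau0 tau4 ytau ye ct tn.
rewrite -/k -/b -/a in T.
(* The constant [14] is [8] from the clique count plus [2 + 4] from the gateways. *)
apply: le_trans (_ : _ <= 1 - (8 * r + (2 * r ^+ h + 4 * (2 ^+ k * (2 ^+ (a * 'C(b, e)))^-1 * 'C(N, a)%:R)) / rho)) _.
  have rn : r <= expR (- (c / 2 * n)).
    by rewrite ler_expR lerN2 ler_wpM2r //; lra.
  (* The condition [c <= gamma / 16] comes from [gamma / 2] times [h >= y / 8]. *)
  have rh : r ^+ h <= expR (- (c * n * y)).
    rewrite -expRM_natl ler_expR mulrN lerN2.
    have : gamma / 2 * n * (y / 8) <= gamma / 2 * n * h%:R.
      by rewrite ler_wpM2l // mulr_ge0 // ltW // divr_gt0.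
    have : c * (n * y) <= gamma / 16 * (n * y) by rewrite ler_wpM2r // mulr_ge0 //; lra.
    lra.
  have E : expR (- (c * n * y)) / rho <= expR (- (c / 2 * n)).
    rewrite /rho -expRN -expRD ler_expR zE.
    have : c / 2 * n <= c / 2 * (n * y) by rewrite ler_wpM2l // ltW // divr_gt0.
    lra.
  set T0 := 2 ^+ k * _ * _ in T *.
  have : (2 * r ^+ h + 4 * T0) / rho <= 6 * (expR (- (c * n * y)) / rho).
    by rewrite mulrA ler_wpM2r ?invr_ge0 ?(ltW rho0) //; lra.
  lra.
apply: le_trans H _; apply: le_expectH => G _; case: asboolP => [P1|_]; last by case: ifP.
rewrite asboolT // => lam lam1; have [K0 [K0c tK]] := P1 lam lam1.
exists K0; split => //; apply: lt_le_trans tK; rewrite lte_fin.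
set x := _ `^ (e%:R)^-1.
have xy : x <= y.
  have fL0 : 0 <= e`!%:R * log2 N%:R :> R by apply: mulr_ge0.
  rewrite yE; apply: ge0_ler_powR; rewrite ?nnegrE ?invr_ge0 //.
  by rewrite ler_peMl // ler1n fact_gt0.
rewrite /powR pnatr_eq0 gtn_eqF // -nE.
(* The time bound exceeds [expR z / 16]; as [z >= 32], half of the exponent absorbs the [16]. *)
apply: (@le_lt_trans _ _ (expR (z / 2))).
  rewrite ler_expR zE.
  have : c / 4 * n * x <= c / 4 * n * y.
    by rewrite ler_wpM2l // mulr_ge0 // ltW // divr_gt0.
  lra.
apply: (@le_lt_trans _ _ ((8 * rho)^-1 / 2)).
  rewrite /rho invfM -expRN opprK (_ : z = z / 2 + z / 2); last by field.
  rewrite expRD (_ : (z / 2 + z / 2) / 2 = z / 2); last by field.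
  have : 1 + z / 2 <= expR (z / 2) by exact: expR_ge1Dx.
  move: (expR _) => w zw.
  have : 16 * w <= w * w by rewrite ler_wpM2r //; lra.
  lra.
by rewrite ltr_pM2r ?invr_gt0 // truncnS_gt.
Qed.

(** * Conclusion *)

Lemma ln_natr_ge_near (R : realType) (C : R) : \forall N \near \oo%classic, C <= ln N%:R.
Proof.
near=> N.
have H : expR C <= N%:R by near: N; exact: nbhs_infty_ger.
by rewrite -ler_expR lnK // posrE; apply: lt_le_trans (expR_gt0 _) H.
Unshelve. all: by end_near. Qed.
Local Open Scope classical_set_scope.
Local Open Scope ring_scope.

Theorem mainTheorem11 (R : realType) (d : nat) (eps beta : R) :
  (2 <= d)%N -> 0 < eps -> 0 < beta -> beta < 1 / 2 ->
  exists c : R, 0 < c /\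
    (fun N : nat =>
       @probG R N d (kappa N beta)
         (fun G => forall lam : R, 1 < lam ->
            exists K0 : {set 'I_N}, is_clique d G K0 /\
              (((N%:R : R) `^ (c * (log2 N%:R) `^ ((d.-1)%:R)^-1))%:E
                < expected_hitting_time d G lam (target_size d N eps) K0)%E))
      @ \oo --> (1 : R).
Proof.
case: d => // e; rewrite ltnS => e0 eps0 beta0 beta2 /=.
pose gamma : R := (1 - 2 * beta) / 4.
have gamma0 : 0 < gamma by rewrite /gamma; lra.
(* One [tau] serves both the room below the target, governed by [eps], and the planted overlaps,
   governed by [beta]. *)
have s0 : 0 < Order.min (2 / 3 * eps) (2 * gamma) by rewrite lt_min; apply/andP; split; lra.
have [tau /andP[tau0 tau4] slack] := @exists_exponent_slack R e _ s0.
have slack1 : (1 + 4 * tau) ^+ e <= 1 + 2 * gamma.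
  by apply: le_trans slack _; rewrite lerD2l ge_min lexx orbT.
have slack2 : (1 + 4 * tau) ^+ e <= 1 + 2 / 3 * eps.
  by apply: le_trans slack _; rewrite lerD2l ge_min lexx.
pose c : R := Order.min (gamma / 16) (tau ^+ 2 / 8).
have c0 : 0 < c by rewrite lt_min; apply/andP; split; rewrite divr_gt0 ?exprn_gt0.
have cg : c <= gamma / 16 by rewrite ge_min lexx.
have ct : c <= tau ^+ 2 / 8 by rewrite ge_min lexx orbT.
exists (c / 4); split; first by rewrite divr_gt0.
have [l0 l1] := ln2_bounds R.
have f0 : 1 <= e`!%:R :> R by rewrite ler1n fact_gt0.
apply/cvgrPdist_le => err err0; near=> N.
set n : R := ln N%:R.
pose y : R := (e`!%:R * log2 N%:R) `^ (e%:R)^-1.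
have n1 : 1 <= n by rewrite /n; near: N; exact: ln_natr_ge_near.
have N0 : (0 < N)%N.
  by rewrite lt0n; apply/eqP => NE; move: n1; rewrite /n NE ln0 //; lra.
have fL0 : 0 <= e`!%:R * log2 N%:R :> R.
  by rewrite mulr_ge0 // divr_ge0 ?(ltW l0) //; apply: le_trans n1.
have yL : y ^+ e = e`!%:R * log2 N%:R.
  rewrite -powR_mulrn ?powR_ge0 // /y -powRrM mulVf ?pnatr_eq0 -?lt0n //.
  by rewrite powRr1.
have ye : y ^+ e * ln 2 = e`!%:R * n.
  by rewrite yL /log2 -mulrA mulfVK // lt0r_neq0.
have y0 : 0 <= y by exact: powR_ge0.
have ny : n <= y ^+ e.
  rewrite -(ler_pM2r l0) ye; apply: (@le_trans _ _ n); first by rewrite ler_piMr //; lra.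
  by rewrite ler_peMl //; lra.
(* Lower bounds on [y] reduce to lower bounds on [n], which hold for large [N]. *)
have y_ge (C : R) : 0 <= C -> C ^+ e <= n -> C <= y.
  move=> C0 Cn; rewrite leNgt; apply/negP => yC.
  have : y ^+ e < C ^+ e by rewrite ltrXn2r // ?nnegrE // -lt0n.
  by rewrite ltNge (le_trans Cn).
have ytau : 2 * e.+1%:R <= tau * y.
  rewrite [leRHS]mulrC -ler_pdivrMr //; apply: y_ge.
    by rewrite divr_ge0 ?(ltW tau0).
  by rewrite /n; near: N; exact: ln_natr_ge_near.
have y1 : 1 <= y.
  by have := scale_ge e0 tau0 tau4 ytau; lra.
(* As [y >= 1], it is at most [y ^+ e], which is linear in [n], so exponentials in [n] dominate
   it. *)
have y2 : 2 * y <= (2 * e`!%:R / ln 2) * n.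
  have : y <= y ^+ e by rewrite ler_eXnr.
  rewrite yL /log2 -/n => yy; apply: le_trans (_ : 2 * (e`!%:R * (n / ln 2)) <= _).
    by rewrite ler_pM2l.
  by rewrite le_eqVlt; apply/orP; left; apply/eqP; field; rewrite lt0r_neq0.
have C0 : 0 <= 2 * e`!%:R / ln 2 :> R by rewrite divr_ge0 ?(ltW l0) // mulr_ge0.
have yb : 2 * y <= expR (beta * n).
  apply: le_trans y2 _; apply: linear_le_expR => //.
  by rewrite /n; near: N; exact: ln_natr_ge_near.
have yg : 2 * y <= expR (gamma / 2 * n).
  apply: le_trans y2 _; apply: linear_le_expR => //; first by rewrite divr_gt0.
  by rewrite /n; near: N; exact: ln_natr_ge_near.
have tn : 16 <= tau ^+ 2 * n.
  rewrite [leRHS]mulrC -ler_pdivrMr ?exprn_gt0 //.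
  by rewrite /n; near: N; exact: ln_natr_ge_near.
have gn : 2 <= gamma * n.
  by rewrite [leRHS]mulrC -ler_pdivrMr //; rewrite /n; near: N; exact: ln_natr_ge_near.
have cn : 64 <= c * n.
  by rewrite [leRHS]mulrC -ler_pdivrMr //; rewrite /n; near: N; exact: ln_natr_ge_near.
have [kapN P] := @planted_slow_probability R e N eps beta tau gamma c n y
  erefl erefl e0 N0 eps0 tau0 tau4 slack1 slack2 erefl gamma0 beta0 ye ytau yb yg tn gn cn c0 cg ct.
rewrite ger0_norm; last by rewrite subr_ge0 probG_le1.
apply: le_trans (_ : 14 * expR (- (c / 2 * n)) <= _); first by lra.
rewrite expRN ler_pdivrMr ?expR_gt0 //.
(* Bounding [expR (c / 2 * n)] below by its exponent leaves [14 <= err * (c / 2 * n)]. *)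
have : 28 / (err * c) <= n by rewrite /n; near: N; exact: ln_natr_ge_near.
rewrite ler_pdivrMr ?mulr_gt0 // => nc.
apply: le_trans (_ : err * (c / 2 * n) <= _); first by lra.
rewrite ler_wpM2l ?(ltW err0) //; apply: le_trans (expR_ge1Dx _); lra.
Unshelve. all: by end_near. Qed.
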